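(* Let $k$ be a field, let $F$ be a free group on a finite alphabet $A$, let $kF$ be its group algebra over $k$, and let $h:F\to(\mathbb{R},+)$ be a group homomorphism. If $\mathbf{u}\in kF$ is $h$-homogeneous of non-zero degree, and is not a monomial, then the centralizer of $\mathbf{u}$ in $kF$ is isomorphic (as a $k$-algebra) to the polynomial ring $k[t]$ in one indeterminate.
   Context: For $\mathbf{u}=\sum_{g\in F}a_g g\in kF$, the support is $\mathrm{Supp}(\mathbf{u})=\{g\in F:a_g\neq 0\}$. A monomial is an element of $kF$ whose support consists of exactly one element. A nonzero element $\mathbf{u}\in kF$ is $h$-homogeneous of degree $a\in\mathbb{R}$ if $h(g)=a$ for all $g\in\mathrm{Supp}(\mathbf{u})$. The centralizer of $\mathbf{u}$ in $kF$ is $\{\mathbf{v}\in kF:\mathbf{u}\mathbf{v}=\mathbf{v}\mathbf{u}\}$. *)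

(* Defs.v *)
From HB Require Import structures.
From mathcomp Require Import all_boot all_order all_algebra.
From mathcomp Require Import finmap monalg.
From mathcomp Require Import reals.

Set Implicit Arguments.
Unset Strict Implicit.
Unset Printing Implicit Defensive.

Import GRing.Theory.

Local Open Scope ring_scope.

(* The free group on [A], as the group of freely reduced words.  The letter
   [(a, true)] is the generator [a] and [(a, false)] is its inverse. *)
Section FreeGroup.
Variable A : choiceType.
Implicit Types (x y : A * bool) (w : seq (A * bool)).

Definition inv_letter x := (x.1, ~~ x.2).

Definition reduced w := sorted (fun x y => y != inv_letter x) w.

Record free_group := FreeGroup { word : seq (A * bool); _ : reduced word }.

HB.instance Definition _ := [isSub for word].
HB.instance Definition _ := [Choice of free_group by <:].

Definition push x w :=
  if w is y :: w' then if y == inv_letter x then w' else x :: w else [:: x].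

Definition mul_word w1 w2 := foldr push w2 w1.

Definition inv_word w := rev (map inv_letter w).

Lemma inv_letterK : involutive inv_letter.
Proof. by case=> a b; rewrite /inv_letter /= negbK. Qed.

Lemma reduced_push x w : reduced w -> reduced (push x w).
Proof.
case: w => [|y w] //= wR; case: (eqVneq y (inv_letter x)) => [_|xy].
  exact: path_sorted wR.
by rewrite /reduced /= xy.
Qed.

Lemma reduced_mul w1 w2 : reduced w2 -> reduced (mul_word w1 w2).
Proof. by move=> w2R; elim: w1 => //= x w1; apply: reduced_push. Qed.

Lemma reduced_inv w : reduced w -> reduced (inv_word w).
Proof.
rewrite /reduced /inv_word rev_sorted sorted_map; apply: sub_sorted => x y /=.
by apply: contraNneq => /(can_inj inv_letterK) ->; rewrite inv_letterK.
Qed.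

Lemma pushK x w : reduced w -> push x (push (inv_letter x) w) = w.
Proof.
case: w => [|y w] /=; first by rewrite eqxx.
rewrite inv_letterK; case: (eqVneq y x) => [-> wR|_ _]; last by rewrite /= eqxx.
case: w wR => [|z w] //= /andP[zx _].
by rewrite (negPf zx).
Qed.

Lemma mul_wordA w1 w2 w3 : reduced w3 ->
  mul_word w1 (mul_word w2 w3) = mul_word (mul_word w1 w2) w3.
Proof.
move=> w3R; elim: w1 => //= x w1 ->.
case: (mul_word w1 w2) => [|y w] //=.
case: eqP => [->|//] /=; rewrite pushK //; exact: reduced_mul.
Qed.

Lemma mul_word1 w : reduced w -> mul_word w [::] = w.
Proof.
elim: w => //= x w IHw wR; rewrite IHw; last exact: path_sorted wR.
by case: w wR {IHw} => [|y w] //= /andP[/negPf->].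
Qed.

Lemma mul_wordVK w w' : reduced w' ->
  mul_word w (mul_word (inv_word w) w') = w'.
Proof.
rewrite /mul_word /inv_word; elim: w w' => //= x w IHw w' w'R.
rewrite rev_cons -cats1 foldr_cat /= IHw ?reduced_push //.
exact: pushK.
Qed.

Lemma inv_wordK : involutive inv_word.
Proof.
by move=> w; rewrite /inv_word map_rev revK -map_comp map_id_in // => x _;
  apply: inv_letterK.
Qed.

Definition free_group_one : free_group := @FreeGroup [::] isT.

Definition free_group_mul (g1 g2 : free_group) : free_group :=
  FreeGroup (reduced_mul (word g1) (valP g2)).

Definition free_group_inv (g : free_group) : free_group :=
  FreeGroup (reduced_inv (valP g)).

Lemma free_group_mulA : associative free_group_mul.
Proof. by move=> g1 g2 g3; apply/val_inj/mul_wordA/(valP g3). Qed.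

Lemma free_group_mul1 : left_id free_group_one free_group_mul.
Proof. by move=> g; apply/val_inj. Qed.

Lemma free_group_1mul : right_id free_group_one free_group_mul.
Proof. by move=> g; apply/val_inj/mul_word1/(valP g). Qed.

Lemma free_group_mulV :
  right_inverse free_group_one free_group_inv free_group_mul.
Proof.
move=> g; apply/val_inj => /=.
by rewrite -[inv_word _]mul_word1 ?mul_wordVK ?reduced_inv ?(valP g).
Qed.

Lemma free_group_Vmul :
  left_inverse free_group_one free_group_inv free_group_mul.
Proof.
move=> g; rewrite -{2}[g](_ : free_group_inv (free_group_inv g) = g).
  exact: free_group_mulV.
exact/val_inj/inv_wordK.
Qed.

HB.instance Definition _ := isGroup.Build free_group
  free_group_mulA free_group_mul1 free_group_1mul
  free_group_Vmul free_group_mulV.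

End FreeGroup.

(* [monalg] only gives [{malg k[G]}] a product when [G] is a [monomType], whose
   sole invertible element is 1, which excludes groups.  The group algebra
   reuses its linear structure and carries the convolution product. *)
Definition group_algebra (k : comNzRingType) (G : groupType) := {malg k[G]}.

Section GroupAlgebra.
Variables (k : comNzRingType) (G : groupType).
Local Notation kG := (group_algebra k G).
Implicit Types u v w : kG.

HB.instance Definition _ := GRing.Lmodule.on kG.

Definition galg_one : kG := << (1 : G)%g >>.

Definition galg_mul u v : kG :=
  \sum_(g1 <- msupp u) \sum_(g2 <- msupp v) << u@_g1 * v@_g2 *g (g1 * g2)%g >>.

Lemma galg_mulw (d1 d2 : {fset G}) u v :
    (msupp u `<=` d1)%fset -> (msupp v `<=` d2)%fset ->
  galg_mul u v =
    \sum_(g1 <- d1) \sum_(g2 <- d2) << u@_g1 * v@_g2 *g (g1 * g2)%g >>.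
Proof.
move=> le_d1 le_d2; rewrite /galg_mul (big_fset_incl _ le_d1) /=.
  apply/eq_bigr=> g1 _; apply/big_fset_incl => // g _ /mcoeff_outdom ->.
  by rewrite mulr0 monalgU0.
move=> g _ /mcoeff_outdom ug.
by rewrite big1 // => g' _; rewrite ug mul0r monalgU0.
Qed.

Lemma galg_mulDl : left_distributive galg_mul +%R.
Proof.
move=> u v w; have sU := fsubsetUl (msupp u) (msupp v).
have sV := fsubsetUr (msupp u) (msupp v).
rewrite (galg_mulw (msuppD_le u v) (fsubset_refl _)).
rewrite (galg_mulw sU (fsubset_refl _)) (galg_mulw sV (fsubset_refl _)).
rewrite -big_split; apply/eq_bigr => g1 _.
rewrite -big_split; apply/eq_bigr => g2 _.
by rewrite mcoeffD mulrDl monalgUD.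
Qed.

Lemma galg_mulDr : right_distributive galg_mul +%R.
Proof.
move=> w u v; have sU := fsubsetUl (msupp u) (msupp v).
have sV := fsubsetUr (msupp u) (msupp v).
rewrite (galg_mulw (fsubset_refl _) (msuppD_le u v)).
rewrite (galg_mulw (fsubset_refl _) sU) (galg_mulw (fsubset_refl _) sV).
rewrite -big_split; apply/eq_bigr => g1 _.
rewrite -big_split; apply/eq_bigr => g2 _.
by rewrite mcoeffD mulrDr monalgUD.
Qed.

Lemma galg_mul0l v : galg_mul 0 v = 0.
Proof. by rewrite /galg_mul msupp0 big_seq_fset0. Qed.

Lemma galg_mul0r u : galg_mul u 0 = 0.
Proof.
by rewrite /galg_mul big1 // => g _; rewrite msupp0 big_seq_fset0.
Qed.

Lemma galg_mulUU (a b : k) (g1 g2 : G) :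
  galg_mul << a *g g1 >> << b *g g2 >> = << a * b *g (g1 * g2)%g >>.
Proof.
by rewrite (galg_mulw msuppU_le msuppU_le) !big_seq_fset1 !mcoeffUU.
Qed.

Lemma galg_scaleU (a b : k) (g : G) :
  a *: (<< b *g g >> : kG) = << a * b *g g >>.
Proof. by apply/malgP => g'; rewrite mcoeffZ !mcoeffU mulrnAr. Qed.

Lemma galg_ind (P : kG -> Prop) :
    P 0 -> (forall u v, P u -> P v -> P (u + v)) ->
    (forall (a : k) (g : G), P << a *g g >>) -> forall u, P u.
Proof. by move=> P0 PD PU u; rewrite [u]monalgE; apply: big_ind. Qed.

Lemma galg_mulA : associative galg_mul.
Proof.
move=> u v w; elim/galg_ind: u => [|u u' Hu Hu'|a g].
- by rewrite !galg_mul0l.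
- by rewrite !galg_mulDl Hu Hu'.
elim/galg_ind: v => [|v v' Hv Hv'|b g'].
- by rewrite galg_mul0l !galg_mul0r galg_mul0l.
- by rewrite galg_mulDl !galg_mulDr galg_mulDl Hv Hv'.
elim/galg_ind: w => [|w w' Hw Hw'|c g''].
- by rewrite !galg_mul0r.
- by rewrite !galg_mulDr Hw Hw'.
by rewrite !galg_mulUU mulrA mulgA.
Qed.

Lemma galg_mul1l : left_id galg_one galg_mul.
Proof.
elim/galg_ind=> [|u v Hu Hv|a g]; first by rewrite galg_mul0r.
  by rewrite galg_mulDr Hu Hv.
by rewrite galg_mulUU mul1r mul1g.
Qed.

Lemma galg_mul1r : right_id galg_one galg_mul.
Proof.
elim/galg_ind=> [|u v Hu Hv|a g]; first by rewrite galg_mul0l.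
  by rewrite galg_mulDl Hu Hv.
by rewrite galg_mulUU mulr1 mulg1.
Qed.

Lemma galg_one_neq0 : galg_one != 0.
Proof. by rewrite monalgU_eq0 oner_eq0. Qed.

HB.instance Definition _ := GRing.Zmodule_isNzRing.Build kG
  galg_mulA galg_mul1l galg_mul1r galg_mulDl galg_mulDr galg_one_neq0.

Lemma galg_scaleAl (a : k) u v : a *: (u * v) = (a *: u) * v.
Proof.
elim/galg_ind: u => [|u u' Hu Hu'|b g]; first by rewrite !(mul0r, scaler0).
  by rewrite mulrDl !scalerDr mulrDl Hu Hu'.
elim/galg_ind: v => [|v v' Hv Hv'|c g']; first by rewrite !(mulr0, scaler0).
  by rewrite mulrDr !scalerDr mulrDr Hv Hv'.
by rewrite /GRing.mul /= galg_mulUU !galg_scaleU galg_mulUU mulrA.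
Qed.

Lemma galg_scaleAr (a : k) u v : a *: (u * v) = u * (a *: v).
Proof.
elim/galg_ind: u => [|u u' Hu Hu'|b g]; first by rewrite !(mul0r, scaler0).
  by rewrite !mulrDl scalerDr Hu Hu'.
elim/galg_ind: v => [|v v' Hv Hv'|c g']; first by rewrite !(mulr0, scaler0).
  by rewrite mulrDr !scalerDr mulrDr Hv Hv'.
by rewrite /GRing.mul /= galg_mulUU !galg_scaleU galg_mulUU mulrCA.
Qed.

HB.instance Definition _ := GRing.Lmodule_isLalgebra.Build k kG galg_scaleAl.
HB.instance Definition _ := GRing.Lalgebra_isAlgebra.Build k kG galg_scaleAr.

Definition monomial u := #|` msupp u| == 1%N.

Definition homogeneous (R : realType) (h : G -> R) (a : R) u :=
  u != 0 /\ forall g, g \in msupp u -> h g = a.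

End GroupAlgebra.

Section Centralizer.
Variables (k : comNzRingType) (B : algType k) (u : B).

Definition centralizer : {pred B} := [pred v | u * v == v * u].

Lemma centralizer_subalg : subalg_closed centralizer.
Proof.
split=> [|a v w|v w]; rewrite !inE.
- by rewrite mulr1 mul1r.
- move=> /eqP uv /eqP uw.
  by rewrite mulrDr mulrDl -scalerAr -scalerAl uv uw.
- by move=> /eqP uv /eqP uw; rewrite mulrA uv -mulrA uw mulrA.
Qed.

HB.instance Definition _ :=
  GRing.isSubalgClosed.Build k B centralizer centralizer_subalg.

Record centralizer_algebra :=
  Centralizer { centralizer_val : B; _ : centralizer_val \in centralizer }.

HB.instance Definition _ := [isSub for centralizer_val].
HB.instance Definition _ := [Choice of centralizer_algebra by <:].
HB.instance Definition _ :=
  [SubChoice_isSubAlgebra of centralizer_algebra by <:].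

End Centralizer.

Definition alg_isomorphic (k : nzRingType) (B C : algType k) :=
  exists f : {lrmorphism B -> C}, bijective f.

(* Main.v *)
(* The free group acts on its Cayley tree, and the diameter of supports in that
   tree is strictly increased by left multiplication with a nonmonomial; it drives
   a Euclidean algorithm on pairs with a common left multiple, so left ideals
   [Ra + Rb] with
   [xa = yb <> 0] are principal (Cohn's weak algorithm).  Applied over [k(s)] to
   [d] and [u - s], for [d] commuting with [u], it shows that a nonzero polynomial
   in [u] is a left multiple of [d].  Combined with Gauss's lemma and with the
   grading by [h], this makes every homogeneous component of the centralizer of
   [u] at most one-dimensional, with degrees commensurable to that of [u] and of
   the same sign.  The same divisibility, applied to [v^n] and [w - s v], lets one
   divide [w] by [v] when [w^n] is a multiple of [v^n]; hence the degrees form a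
   monoid generated by the degree of a homogeneous element [t] of positive degree
   and minimal diameter, and the centralizer is [k[t]]. *)

Require Import Defs.
From HB Require Import structures.
From mathcomp Require Import all_boot all_order all_algebra.
From mathcomp Require Import generic_quotient finmap monalg.
From mathcomp Require Import boolp reals.
From mathcomp Require Import zify.

Set Implicit Arguments.
Unset Strict Implicit.
Unset Printing Implicit Defensive.

Import Order.TTheory GRing.Theory Num.Theory.
Local Open Scope ring_scope.

(** * Lengths of reduced words *)

(** Divisibility in kG is one-sided, and for a fixed scalar c the elements d and u - c may share a
    nonunit right divisor. This is why s is transcendental: a common right divisor of d and u - s
    over k(s) divides the constant d, so by Gauss's lemma it can be taken over k; it then divides u
    and -1 separately and is a unit. Clearing denominators in the resulting Bezout identity produces
    the polynomial D for which D(u) is a left multiple of d. With w - s v in place of u - s, the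
    divisor divides v instead of -1, so v itself lies in the left ideal of v^n and w - s v. That u
    is not a monomial enters through units: left multiplication by a nonmonomial raises the
    diameter, so only monomials have a right inverse. *)

Section CommonPrefix.
Variable T : eqType.
Implicit Types s t r : seq T.

Fixpoint lcp s t : nat :=
  if s is x :: s' then if t is y :: t' then
    if x == y then (lcp s' t').+1 else 0%N else 0%N else 0%N.

Lemma lcpC s t : lcp s t = lcp t s.
Proof.
by elim: s t => [|x s IH] [|y t] //=; rewrite eq_sym; case: eqP => // _; rewrite IH.
Qed.

(** The prefixes that [t] shares with [s] and with [r] are comparable, and the shorter one is a
    prefix of both [s] and [r]. *)
Lemma lcp_ultra s t r : (minn (lcp s t) (lcp t r) <= lcp s r)%N.
Proof.
elim: s t r => [|x s IH] [|y t] r //=.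
  by rewrite min0n.
case: (eqVneq x y) => [->|_]; last by rewrite min0n.
case: r => [|z r]; first by rewrite minn0.
by case: eqP => // _; rewrite ?minn0 // minnSS ltnS.
Qed.

Lemma nth_lcp x0 s t i : (i < lcp s t)%N -> nth x0 s i = nth x0 t i.
Proof.
elim: s t i => [|x s IH] [|y t] //= i; case: eqP => // <-.
by case: i => //= i; apply: IH.
Qed.

End CommonPrefix.

(* The length of [g] is the displacement of a base vertex under a free action on
   a simplicial tree without inversions; [tree_far] expresses that a nontrivial
   element moves its displaced points further and further. *)
Section TreeLength.
Variables (G : groupType) (len : G -> nat).
Implicit Types f g p q r : G.

Definition dist g q := len (g^-1 * q)%g.

(** [tree_four_point] is the four-point condition of a tree for [q], [r1], [r2] and the base vertex,
    whose distance to [g] is [len g]. The algebra below uses no other fact about words. *)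
Record tree_length : Prop := TreeLength {
  tree_len1 : len 1%g = 0%N;
  tree_lenV : forall g, len (g^-1)%g = len g;
  tree_four_point : forall q r1 r2,
    (dist r1 r2 + len q <= maxn (dist q r1 + len r2) (dist q r2 + len r1))%N;
  tree_far : forall f q q' r L, f != 1%g -> len q = L -> len q' = L ->
    (len r <= L)%N -> (len (f * q)%g <= L)%N -> (len (f^-1 * q')%g <= L)%N ->
    (len (f * r)%g <= L)%N -> (dist q r < dist q q')%N }.

Hypothesis lenP : tree_length.

Lemma distgg g : dist g g = 0%N.
Proof. by rewrite /dist mulVg tree_len1. Qed.

Lemma distC g q : dist g q = dist q g.
Proof. by rewrite /dist -tree_lenV // invgM invgK. Qed.

Lemma dist_mul f g q : dist (f * g)%g (f * q)%g = dist g q.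
Proof. by rewrite /dist invgM mulgA -(mulgA (g^-1)%g) mulVg mulg1. Qed.

(** With [q], [q'] and [r] all equal to [p], [tree_far] would give [dist p p < dist p p]. All
    unique-product arguments rest on this: [f] and its inverse cannot both keep [p] in the ball of
    radius [len p]. *)
Lemma len_expand f p : f != 1%g ->
  (len p < len (f * p)%g)%N || (len p < len (f^-1 * p)%g)%N.
Proof.
move=> f1; apply/negPn/negP; rewrite negb_or -!leqNgt => /andP[l1 l2].
have := tree_far lenP f1 erefl erefl (leqnn (len p)) l1 l2 l1.
by rewrite ltnn.
Qed.

Lemma dist_expand f p q : f != 1%g ->
  (dist q p < dist q (f * p)%g)%N || (dist q p < dist q (f^-1 * p)%g)%N.
Proof.
move=> f1; rewrite /dist.
have := @len_expand (q^-1 * f * q)%g (q^-1 * p)%g.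
rewrite !invgM !invgK !mulgA mulgK -!(mulgA _ q) mulgV !mulg1.
apply; apply: contra f1 => /eqP e.
apply/eqP/(@mulIg _ q)/(@mulgI _ (q^-1)%g).
by rewrite mul1g mulVg mulgA e.
Qed.

End TreeLength.

(** * Word length on the free group *)

Section WordLength.
Variable A : choiceType.
Implicit Types (f g p q r : free_group A) (w : seq (A * bool)).

Definition word_len g := size (word g).
Local Notation len := word_len.
Local Notation dist := (dist word_len).

Lemma inv_letter_neq (x : A * bool) : inv_letter x != x.
Proof. by case: x => a []; rewrite /inv_letter xpair_eqE andbF. Qed.

(** Letters cancel at the junction as long as the inverse of [w1] agrees with [w2]. The induction
    removes the last letter of [w1] because [mul_word] pushes that one first. *)
Lemma size_mul_word w1 w2 : reduced w1 ->
  (size (mul_word w1 w2) + (lcp (inv_word w1) w2).*2 = size w1 + size w2)%N.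
Proof.
elim/last_ind: w1 w2 => [|w x IH] w2 //; first by rewrite addn0.
move=> wR; have w'R : reduced w.
  by case: (w) wR => //= a l; rewrite /reduced /= rcons_path => /andP[].
rewrite /mul_word foldr_rcons -/(mul_word _ _) /inv_word map_rcons rev_rcons.
rewrite -/(inv_word w) size_rcons.
(* Since [rcons w x] is reduced, no letter of [w] cancels once [x] stays in front of [w2]. *)
have base : lcp (inv_word w) (x :: w2) = 0%N.
  case/lastP: w wR {IH w'R} => [|w y] //.
  rewrite /inv_word map_rcons rev_rcons /= /reduced -!cats1 -catA.
  case: w => [|a l] /=.
    by rewrite andbT eq_sym => /negPf->.
  by rewrite cat_path /= => /and3P[_ _]; rewrite andbT eq_sym => /negPf->.
case: w2 base => [|y w2] base /=.
  by have := IH [:: x] w'R; rewrite base /=; lia.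
rewrite eq_sym; case: eqP => [_|_] /=.
  by have := IH w2 w'R; lia.
by have := IH [:: x, y & w2] w'R; rewrite base /=; lia.
Qed.

Lemma len_mul f g :
  (len (f * g)%g + (lcp (word (f^-1)%g) (word g)).*2 = len f + len g)%N.
Proof. exact/size_mul_word/(valP f). Qed.

Lemma lenV g : len (g^-1)%g = len g.
Proof. by rewrite /word_len /= /inv_word size_rev size_map. Qed.

Lemma dist_lcp g q :
  (dist g q + (lcp (word g) (word q)).*2 = len g + len q)%N.
Proof. by rewrite /dist -(lenV g) -len_mul invgK. Qed.

Lemma len_eq0 g : (len g == 0%N) = (g == 1%g).
Proof. by rewrite /word_len size_eq0 -val_eqE. Qed.

(** If [f] agreed with its inverse for half its length, the middle letter would be its own inverse
    (odd length), or the two middle letters would cancel (even length). *)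
Lemma lcp_inv f : f != 1%g -> ((lcp (word f) (word (f^-1)%g)).*2 < len f)%N.
Proof.
rewrite -len_eq0 -lt0n /len => f0.
have fR : reduced (word f) by exact: (valP f).
rewrite ltnNge; apply/negP => le.
case E: (word f) f0 => [|x0 w] // f0; rewrite -E in f0.
set n := size (word f) in f0 le.
have inv i : (i < n)%N -> nth x0 (word (f^-1)%g) i = inv_letter (nth x0 (word f) (n - i.+1)).
  move=> lt; rewrite /= /inv_word nth_rev ?size_map // (nth_map x0) //.
  by rewrite -/n ltn_subrL.
have mid : (n.-1./2 < lcp (word f) (word (f^-1)%g))%N by lia.
have e := nth_lcp x0 mid; rewrite inv in e; last by lia.
have [odd_n|even_n] := boolP (odd n).
  have e2 : (n - n.-1./2.+1)%N = n.-1./2 by lia.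
  by move: e; rewrite e2 => /eqP; rewrite eq_sym (negPf (inv_letter_neq _)).
have e2 : (n - n.-1./2.+1)%N = n.-1./2.+1 by lia.
rewrite e2 in e.
have lt : (n.-1./2.+1 < n)%N by lia.
have := sortedP x0 fR _ lt; rewrite e.
by rewrite inv_letterK eqxx.
Qed.

Lemma four_point q r1 r2 :
  (dist r1 r2 + len q <= maxn (dist q r1 + len r2) (dist q r2 + len r1))%N.
Proof.
have := lcp_ultra (word r1) (word q) (word r2).
rewrite (lcpC (word r1) (word q)).
have := dist_lcp q r1; have := dist_lcp q r2; have := dist_lcp r1 r2.
lia.
Qed.

(** The bounds on [f * q] and [f^-1 * q'] make [q] start with at least half of the inverse of [f],
    and [q'] with at least half of [f]. By [lcp_inv] these two diverge earlier, so [dist q q']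
    exceeds [2L - len f], while the bounds on [f * q] and [f * q2] keep [dist q q2] at most
    [2L - len f]. *)
Lemma dist_far f q q' q2 L : f != 1%g -> len q = L -> len q' = L ->
  (len q2 <= L)%N -> (len (f * q)%g <= L)%N -> (len (f^-1 * q')%g <= L)%N ->
  (len (f * q2)%g <= L)%N -> (dist q q2 < dist q q')%N.
Proof.
move=> f1 q_L q'_L q2_L fq fq' fq2.
have := lcp_inv f1; have := len_mul f q; have := len_mul (f^-1)%g q'.
have := len_mul f q2; have := dist_lcp q q2; have := dist_lcp q q'.
rewrite invgK lenV.
have := lcp_ultra (word q) (word (f^-1)%g) (word q2).
have := lcp_ultra (word f) (word q') (word (f^-1)%g).
have := lcp_ultra (word q') (word q) (word (f^-1)%g).
rewrite (lcpC (word q) (word (f^-1)%g)) (lcpC (word q') (word q)).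
move: (len (f * q)%g) (len (f^-1 * q')%g) (len (f * q2)%g) fq fq' fq2.
move: (dist q q2) (dist q q') (lcp (word f) _) (lcp _ (word q)) (lcp _ (word q2)).
lia.
Qed.

Lemma word_tree_length : tree_length word_len.
Proof.
split=> [|g|q r1 r2|f q q' r L]; first by [].
- exact: lenV.
- exact: four_point.
- exact: dist_far.
Qed.

End WordLength.

(** * Group algebras *)

Section GroupAlgebraTheory.
Variables (k : comNzRingType) (G : groupType).
Local Notation kG := (group_algebra k G).
Implicit Types (u v x y z : kG) (g h p : G) (a b : k).

Lemma galgP u v : (forall g, u@_g = v@_g) -> u = v.
Proof. by move=> uv; apply/malgP. Qed.

Lemma galg0E p : (0 : kG)@_p = 0.
Proof. exact: mcoeff0. Qed.

Lemma galgDE u v p : (u + v)@_p = u@_p + v@_p.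
Proof. exact: mcoeffD. Qed.

Lemma galgBE u v p : (u - v)@_p = u@_p - v@_p.
Proof. exact: mcoeffB. Qed.

Lemma galgZE a u p : (a *: u)@_p = a * u@_p.
Proof. exact: mcoeffZ. Qed.

Lemma galg_sumE (I : Type) (s : seq I) (P : pred I) (E : I -> kG) p :
  (\sum_(i <- s | P i) E i)@_p = \sum_(i <- s | P i) (E i)@_p.
Proof. exact: raddf_sum. Qed.

Lemma galgUM a b g h :
  (<< a *g g >> : kG) * << b *g h >> = << a * b *g (g * h)%g >>.
Proof. exact: galg_mulUU. Qed.

Lemma galg_sum u : u = \sum_(g <- msupp u) (<< u@_g *g g >> : kG).
Proof. exact: monalgE. Qed.

Lemma mcoeff_galgUl a g u p : ((<< a *g g >> : kG) * u)@_p = a * u@_(g^-1 * p)%g.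
Proof.
elim/galg_ind: u => [|u v Hu Hv|b h].
- by rewrite mulr0 !mcoeff0 mulr0.
- by rewrite mulrDr !mcoeffD Hu Hv mulrDr.
rewrite galgUM !mcoeffU mulrnAr; congr (_ *+ nat_of_bool _).
by apply/eqP/eqP => [<-|->]; rewrite mulgA ?mulVg ?mulgV mul1g.
Qed.

Lemma galg_mulE u v : u * v = \sum_(g <- msupp u) (<< u@_g *g g >> : kG) * v.
Proof. by rewrite {1}[u]galg_sum mulr_suml. Qed.

Lemma mcoeffM u v p : (u * v)@_p = \sum_(g <- msupp u) u@_g * v@_(g^-1 * p)%g.
Proof.
by rewrite galg_mulE raddf_sum; apply: eq_bigr => g _ /=; apply: mcoeff_galgUl.
Qed.

Lemma mcoeff_galg1 p : (1 : kG)@_p = (p == 1%g)%:R.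
Proof. by rewrite [1]/(galg_one _ _) /galg_one mcoeffU eq_sym. Qed.

Lemma galg_neq0 u : u != 0 -> exists g, g \in msupp u.
Proof.
move=> u0; apply/fset0Pn; apply: contra_neq u0 => su.
by rewrite [u]galg_sum su big_seq_fset0.
Qed.

End GroupAlgebraTheory.

Section CoefficientMap.
Variables (k K : comNzRingType) (G : groupType).

Definition gmap (f : k -> K) (u : group_algebra k G) : group_algebra K G :=
  [malg g in msupp u => f u@_g].

Lemma mcoeff_gmap (f : {additive k -> K}) u g : (gmap f u)@_g = f u@_g.
Proof.
rewrite /gmap mcoeffE; case: ifPn => // /mcoeff_outdom ->.
by rewrite raddf0.
Qed.

Lemma gmap_additive (f : {additive k -> K}) : {morph gmap f : u v / u - v}.
Proof. by move=> u v; apply/galgP => g; rewrite !(mcoeff_gmap, mcoeffB) raddfB. Qed.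

HB.instance Definition _ (f : {additive k -> K}) :=
  GRing.isZmodMorphism.Build (group_algebra k G) (group_algebra K G) (gmap f)
    (gmap_additive f).

Lemma gmapU (f : {additive k -> K}) a g : gmap f << a *g g >> = << f a *g g >>.
Proof.
by apply/galgP => h; rewrite mcoeff_gmap !mcoeffU raddfMn.
Qed.

Lemma gmap_multiplicative (f : {rmorphism k -> K}) : monoid_morphism (gmap f).
Proof.
split=> [|u v]; first by rewrite [1]/(galg_one _ _) /galg_one gmapU /= rmorph1.
rewrite [u]galg_sum [v]galg_sum mulr_suml !raddf_sum /= mulr_suml.
apply: eq_bigr => g _; rewrite !mulr_sumr raddf_sum /=.
by apply: eq_bigr => h _; rewrite galgUM !gmapU galgUM /= rmorphM.
Qed.

HB.instance Definition _ (f : {rmorphism k -> K}) :=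
  GRing.isMonoidMorphism.Build (group_algebra k G) (group_algebra K G) (gmap f)
    (gmap_multiplicative f).

Lemma gmap_inj (f : {additive k -> K}) : injective f -> injective (gmap f).
Proof.
move=> f_inj u v uv; apply/galgP => g; apply: f_inj.
by rewrite -!mcoeff_gmap uv.
Qed.

Lemma gmapZ (f : {rmorphism k -> K}) a u : gmap f (a *: u) = f a *: gmap f u.
Proof. by apply/galgP => g; rewrite !(mcoeff_gmap, mcoeffZ) /= rmorphM. Qed.

End CoefficientMap.

Lemma seq_argmax (T : eqType) (F : T -> nat) (s : seq T) x0 : x0 \in s ->
  exists2 x, x \in s & forall y, y \in s -> (F y <= F x)%N.
Proof.
elim: s x0 => // x s IH x0 _; case: s IH => [|y s] IH.
  by exists x; rewrite ?mem_head // => y; rewrite inE => /eqP->.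
have [z zs zmax] := IH y (mem_head _ _).
have [xz|zx] := leqP (F x) (F z).
  exists z; first by rewrite inE zs orbT.
  by move=> t; rewrite inE => /predU1P[->//|/zmax].
exists x; first by rewrite mem_head.
move=> t; rewrite inE => /predU1P[->//|/zmax tz].
exact: leq_trans tz (ltnW zx).
Qed.

Lemma sum_neq0 (V : nmodType) (T : eqType) (s : seq T) (P : pred T) (F : T -> V) :
  \sum_(i <- s | P i) F i != 0 -> exists2 i, i \in s & P i && (F i != 0).
Proof.
move=> S0; have [/hasP[i si Fi]|n] := boolP (has (fun i => P i && (F i != 0)) s).
  by exists i.
case/eqP: S0; rewrite big_seq_cond big1 // => i /andP[si Pi].
by apply/eqP/negPn; apply: contra n => Fi; apply/hasP; exists i; rewrite ?Pi.
Qed.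

(** * Unique products *)

Section UniqueProduct.
Variables (G : groupType) (len : G -> nat).
Hypothesis lenP : tree_length len.
Implicit Types (f g p q r : G).

(** Take a product [g * h] of maximal length. If [g' * h'] equals it with [g' != g], then
    [g' * g^-1] and its inverse send it to [g' * h] and [g * h'], one of which is longer by
    [len_expand]. *)
Lemma uniq_product (X Y : seq G) g0 h0 : g0 \in X -> h0 \in Y ->
  exists g h, [/\ g \in X, h \in Y &
    forall g' h', g' \in X -> h' \in Y -> (g' * h' = g * h)%g -> g' = g].
Proof.
move=> Xg0 Yh0.
have XY0 : (g0, h0) \in [seq (g, h) | g <- X, h <- Y] by apply: allpairs_f.
have [_ /allpairsP[[g h] /= [Xg Yh ->]] /= gh_max] :=
  seq_argmax (fun gh => len (gh.1 * gh.2)%g) XY0.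
have {}gh_max g' h' : g' \in X -> h' \in Y -> (len (g' * h')%g <= len (g * h)%g)%N.
  by move=> Xg' Yh'; apply: (gh_max (g', h')); apply: allpairs_f.
exists g, h; split=> // g' h' Xg' Yh' e.
have [//|g'g] := eqVneq g' g.
have f1 : (g' * g^-1)%g != 1%g by apply: contra g'g => /eqP/divg1_eq ->.
have := len_expand lenP (g * h)%g f1.
rewrite {1}[(_ * (g * h))%g]mulgA mulgVK -e invgM invgK !mulgA mulgVK.
by rewrite e ltnNge gh_max //= ltnNge gh_max.
Qed.

End UniqueProduct.

Section UniqueProductDomain.
Variables (G : groupType) (len : G -> nat) (D : comNzRingType).
Hypothesis lenP : tree_length len.
Local Notation DG := (group_algebra D G).
Implicit Types (u v x y z : DG) (g h p : G).

Lemma mcoeffM_uniq x y g h : g \in msupp x ->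
    (forall g', g' \in msupp x -> (g'^-1 * (g * h))%g \in msupp y -> g' = g) ->
  (x * y)@_(g * h)%g = x@_g * y@_h.
Proof.
move=> xg uniq; rewrite mcoeffM (big_fsetD1 g) //= mulKg big_seq big1 ?addr0 //.
move=> g'; rewrite !inE => /andP[g'g xg'].
have [/uniq e|/mcoeff_outdom->] := boolP ((g'^-1 * (g * h))%g \in msupp y).
  by rewrite e ?eqxx in g'g.
by rewrite mulr0.
Qed.

(* Gauss's lemma for a prime ideal [P], with unique products instead of leading
   monomials. *)
Lemma prime_mcoeff (P : D -> Prop) x y : P 0 ->
    (forall a b, P a -> P b -> P (a - b)) -> (forall a b, P a -> P (b * a)) ->
    (forall a b, P (a * b) -> P a \/ P b) -> (forall a, P a \/ ~ P a) ->
    (forall p, P (x * y)@_p) ->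
  (forall g, P x@_g) \/ (forall g, P y@_g).
Proof.
move=> P0 PB PM Pprime Pdec Pxy.
have PD a b : P a -> P b -> P (a + b).
  by move=> Pa Pb; rewrite -[b]opprK -[- b]add0r; apply: (PB) => //; apply: (PB).
have Psum (s : seq G) (E : G -> D) : (forall g, g \in s -> P (E g)) -> P (\sum_(g <- s) E g).
  by move=> PE; rewrite big_seq; apply: big_ind.
pose dP a := boolp.asbool (P a).
have sub z : (forall g, P z@_g) \/ (exists2 g, g \in [seq g <- msupp z | ~~ dP z@_g] & True).
  case: (boolP (has (fun g => ~~ dP z@_g) (msupp z))) => [/hasP[g zg Pg]|n].
    by right; exists g; rewrite // mem_filter Pg.
  left=> g; have [zg|/mcoeff_outdom->//] := boolP (g \in msupp z).
  apply/boolp.asboolP; apply: contraNT n => Pg.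
  by apply/hasP; exists g.
have [|[g0 xg0 _]] := sub x; first by left.
have [|[h0 yh0 _]] := sub y; first by right.
(* The unique product is taken among the coefficients outside [P], so modulo [P] the coefficient of
   [x * y] at [g * h] is [x@_g * y@_h]. *)
have [g [h [xg yh uniq]]] := uniq_product lenP xg0 yh0.
move: xg yh; rewrite !mem_filter => /andP[/boolp.asboolPn Pg xg] /andP[/boolp.asboolPn Ph yh].
have := Pxy (g * h)%g; rewrite mcoeffM (big_fsetD1 g) //= mulKg.
set S := \sum_(_ <- _) _ => PS.
suff PS' : P S.
  have := PB _ _ PS PS'; rewrite addrK => /Pprime.
  by case.
apply: Psum => g'; rewrite !inE => /andP[g'g xg'].
have [Pg'|nPg'] := Pdec x@_g'; first by rewrite mulrC; apply: PM.
have [Ph'|nPh'] := Pdec y@_(g'^-1 * (g * h))%g; first exact: PM.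
case/eqP: g'g; apply: (uniq _ (g'^-1 * (g * h))%g); last by rewrite mulVKg.
  by rewrite mem_filter xg' andbT; apply/boolp.asboolPn.
rewrite mem_filter; apply/andP; split; first exact/boolp.asboolPn.
by rewrite -mcoeff_neq0; apply/eqP => e; apply: nPh'; rewrite e.
Qed.

End UniqueProductDomain.

Section GroupAlgebraDomain.
Variables (G : groupType) (len : G -> nat) (D : idomainType).
Hypothesis lenP : tree_length len.
Local Notation DG := (group_algebra D G).
Implicit Types (u v x y z : DG) (g h p : G).

Lemma galg_mulf_eq0 x y : x * y = 0 -> x = 0 \/ y = 0.
Proof.
move=> xy0.
have [| | | | | |x0|y0] := @prime_mcoeff G len D lenP (fun a => a = 0) x y.
- by [].
- by move=> a b -> ->; rewrite subr0.
- by move=> a b ->; rewrite mulr0.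
- by move=> a b /eqP; rewrite mulf_eq0 => /orP[]/eqP; [left|right].
- by move=> a; have [->|/eqP] := eqVneq a 0; [left|right].
- by move=> p; rewrite xy0 galg0E.
- by left; apply/galgP => g; rewrite x0 galg0E.
- by right; apply/galgP => g; rewrite y0 galg0E.
Qed.

Lemma galg_mulf_neq0 x y : x != 0 -> y != 0 -> x * y != 0.
Proof. by move=> x0 y0; apply/eqP => /galg_mulf_eq0[]; apply/eqP. Qed.

Lemma galg_mulIf y : y != 0 -> injective ( *%R^~ y : DG -> DG).
Proof.
move=> y0 x x' /= e; have : (x - x') * y = 0 by rewrite mulrBl e subrr.
case/galg_mulf_eq0; first exact: subr0_eq.
by move=> y_0; rewrite y_0 eqxx in y0.
Qed.

Lemma galg_expf_neq0 x n : x != 0 -> x ^+ n != 0.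
Proof.
by move=> x0; elim: n => [|n IH]; rewrite ?oner_neq0 // exprS galg_mulf_neq0.
Qed.

End GroupAlgebraDomain.

(** * Diameters and the weak algorithm *)

Section Diameter.
Variables (G : groupType) (len : G -> nat) (k : fieldType).
Hypothesis lenP : tree_length len.
Local Notation dist := (dist len).
Local Notation kG := (group_algebra k G).
Implicit Types (u v x y z a b : kG) (g h p q : G).

Definition diam u : nat :=
  (\max_(g <- msupp u) \max_(h <- msupp u) dist g h)%N.
Arguments diam u%_R.

Lemma leq_diam u g h : g \in msupp u -> h \in msupp u -> (dist g h <= diam u)%N.
Proof.
move=> ug uh; apply: leq_trans (_ : \max_(h <- msupp u) dist g h <= _)%N.
  exact: (leq_bigmax_seq (F := fun h => dist g h)).
exact: (leq_bigmax_seq (F := fun g => \max_(h <- msupp u) dist g h)%N).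
Qed.

Lemma diam_leq u n :
    (forall g h, g \in msupp u -> h \in msupp u -> (dist g h <= n)%N) ->
  (diam u <= n)%N.
Proof.
move=> un; apply/bigmax_leqP_seq => g ug _; apply/bigmax_leqP_seq => h uh _.
exact: un.
Qed.

Lemma diam_witness u : u != 0 ->
  exists g h, [/\ g \in msupp u, h \in msupp u & dist g h = diam u].
Proof.
move=> /galg_neq0[g0 ug0].
have uu0 : (g0, g0) \in [seq (g, h) | g <- msupp u, h <- msupp u].
  exact: allpairs_f.
have [_ /allpairsP[[g h] /= [ug uh ->]] /= gh_max] :=
  seq_argmax (fun gh => dist gh.1 gh.2) uu0.
exists g, h; split=> //; apply/eqP; rewrite eqn_leq leq_diam //=.
apply: diam_leq => g' h' ug' uh'; apply: (gh_max (g', h')).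
exact: allpairs_f.
Qed.

Lemma diamUl (c : k) g u : (diam ((<< c *g g >> : kG) * u) <= diam u)%N.
Proof.
have sub p : p \in msupp ((<< c *g g >> : kG) * u) -> (g^-1 * p)%g \in msupp u.
  rewrite -!mcoeff_neq0 mcoeff_galgUl; apply: contraNneq => ->.
  by rewrite mulr0.
apply: diam_leq => p q /sub up /sub uq.
by rewrite -(dist_mul len (g^-1)%g) leq_diam.
Qed.

Lemma diam_monomial u : monomial u -> diam u = 0%N.
Proof.
rewrite /monomial => /cardfs1P[g ug]; apply/eqP; rewrite -leqn0.
by apply: diam_leq => p q; rewrite ug !inE => /eqP-> /eqP->; rewrite (distgg lenP).
Qed.

Lemma nonmonomialP u : u != 0 -> ~~ monomial u ->
  exists g h, [/\ g \in msupp u, h \in msupp u & g != h].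
Proof.
move=> /galg_neq0[g ug] mu; exists g.
have [h gh|n] := pickP (fun h : msupp u => g != val h).
  by exists (val h); split=> //; apply: valP.
case/negP: mu; rewrite /monomial; apply/cardfs1P; exists g; apply/fsetP => h.
rewrite inE; apply/idP/eqP => [uh|->//].
by have := n [` uh]%fset; rewrite /= => /negbFE/eqP.
Qed.

(** Products at maximal distance survive in [x * y]. A second factorization of such an endpoint [r]
    would give an element which, together with its inverse, moves [r] to two further products, one
    of them farther from the other endpoint by [dist_expand]. So [r] factors uniquely and its
    coefficient is nonzero. *)
Lemma dist_mul_supp x y p q : x != 0 -> y != 0 ->
    (exists g h, [/\ g \in msupp x, h \in msupp y & p = (g * h)%g]) ->
    (exists g h, [/\ g \in msupp x, h \in msupp y & q = (g * h)%g]) ->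
  (dist p q <= diam (x * y))%N.
Proof.
move=> x0 y0 [g [h [xg yh ->]]] [g' [h' [xg' yh' ->]]] {p q}.
pose P := [seq (g * h)%g | g <- msupp x, h <- msupp y].
have PP : ((g * h)%g, (g' * h')%g) \in [seq (p, q) | p <- P, q <- P].
  by apply: allpairs_f; apply: allpairs_f.
have [[p q]] := seq_argmax (fun pq => dist pq.1 pq.2) PP.
move=> /allpairsP[[p' q'] /= [Pp Pq [-> ->]]] {p q} pq_max.
have far r s : r \in P -> s \in P -> (dist r s <= dist p' q')%N.
  by move=> Pr Ps; apply: (pq_max (r, s)); apply: allpairs_f.
suff supp r s : r \in P -> s \in P -> dist r s = dist p' q' -> r \in msupp (x * y).
  apply: leq_trans (far _ _ (allpairs_f _ xg yh) (allpairs_f _ xg' yh')) _.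
  by apply: leq_diam; [exact: (supp _ q')|apply: (supp _ p'); rewrite // (distC lenP)].
move=> {Pp Pq} /[dup] Pr /allpairsP[[g1 h1] /= [xg1 yh1 rE]] Ps rs.
rewrite -mcoeff_neq0 rE mcoeffM_uniq //; first by rewrite mulf_neq0 // mcoeff_neq0.
move=> g2 xg2; rewrite -rE; set h2 := (_ * r)%g => yh2.
have r2 : r = (g2 * h2)%g by rewrite mulVKg.
apply/eqP; rewrite -divg_eq1; apply: contraT => f1.
have e1 : (g2 / g1 * r = g2 * h1)%g by rewrite rE mulgA mulgVK.
have e2 : ((g2 / g1)^-1 * r = g1 * h2)%g by rewrite r2 invgF mulgA mulgVK.
have := dist_expand lenP r s f1; rewrite e1 e2 (distC lenP s r) rs !ltnNge.
by rewrite !(distC lenP s) !far //; apply: allpairs_f.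
Qed.

(** Let [h], [h'] be the ends of a diameter of [y], and [g], [g'] distinct in the support of [x]. By
    [dist_expand], one of the crossed pairs [(g * h', g' * h)] and [(g' * h', g * h)] is farther
    apart than [(h', h)]. *)
Lemma diam_lt_mul x y : x != 0 -> ~~ monomial x -> y != 0 ->
  (diam y < diam (x * y))%N.
Proof.
move=> x0 /(nonmonomialP x0)[g [g' [xg xg' gg']]] y0.
have [h [h' [yh yh' <-]]] := diam_witness y0.
have f1 : (g^-1 * g')%g != 1%g.
  by apply: contra gg' => /eqP e; rewrite -[g]mulg1 -e mulVKg.
have /orP[] := dist_expand lenP h' h f1 => lt; apply: leq_trans lt _.
  rewrite -(dist_mul len g) !mulgA mulgV mul1g.
  by apply: dist_mul_supp => //; [exists g, h|exists g', h'].
rewrite -(dist_mul len g') invgM invgK !mulgA mulgV mul1g.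
by apply: dist_mul_supp => //; [exists g', h|exists g, h'].
Qed.

(** A nonzero scalar has diameter 0, which cannot exceed the diameter of [y]. *)
Lemma unit_monomial x y c : c != 0 -> x * y = c *: (1 : kG) -> monomial x.
Proof.
move=> c0 xy; apply: contraT => mx.
have xy0 : x * y != 0.
  rewrite xy; apply/eqP => e; have := mcoeff_galg1 k (1%g : G).
  move/(congr1 (fun t => c * t)); rewrite -galgZE [_ *: _]e galg0E eqxx mulr1.
  by move/esym/eqP; rewrite (negPf c0).
have x0 : x != 0 by apply: contraNneq xy0 => ->; rewrite mul0r.
have y0 : y != 0 by apply: contraNneq xy0 => ->; rewrite mulr0.
have := diam_lt_mul x0 mx y0; rewrite xy ltnNge (_ : diam _ = 0%N) //.
apply: diam_monomial; rewrite /monomial.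
rewrite [_ *: _](_ : _ = << c *g 1%g >>); first by rewrite msuppU (negPf c0) cardfs1.
by rewrite [1]/(galg_one _ _) /galg_one galg_scaleU mulr1.
Qed.

End Diameter.
Arguments diam {G} len {k} u%_R.

(** * The division step of the weak algorithm *)

Section WeakAlgorithm.
Variables (G : groupType) (len : G -> nat) (k : fieldType).
Hypothesis lenP : tree_length len.
Local Notation dist := (dist len).
Local Notation diam := (diam len).
Local Notation kG := (group_algebra k G).
Implicit Types (u v x y z a b : kG) (g h p q : G).

Lemma mem_msuppB u v p : p \in msupp (u - v) -> (p \in msupp u) || (p \in msupp v).
Proof.
rewrite -!mcoeff_neq0 galgBE; apply: contraNT; rewrite negb_or !negbK.
by move=> /andP[/eqP-> /eqP->]; rewrite subr0.
Qed.

Lemma mcoeffM_neq0 u v p : (u * v)@_p != 0 ->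
  exists2 g, g \in msupp u & (g^-1 * p)%g \in msupp v.
Proof.
rewrite mcoeffM => /sum_neq0[g ug /= c0]; exists g => //.
by rewrite -mcoeff_neq0; apply: contraNneq c0 => ->; rewrite mulr0.
Qed.

(** Let [L] be the maximal length of a product of support elements on either side, reached by
    [g0 * h0] in [x * a]. From the translate of [a] by [g0], a left multiple of [b] is subtracted so
    that all terms of length [L] cancel. The rest stays within [diam a] of [g0 * h0], and the
    four-point condition turns the drop in length into a drop in diameter. *)
Lemma weak_algorithm a b x y : a != 0 -> b != 0 -> x != 0 -> x * a = y * b ->
    (diam b <= diam a)%N ->
  exists c, a = c * b \/ (diam (a - c * b) < diam a)%N.
Proof.
move=> a0 b0 x0 xayb le_ba.
have y0 : y != 0.
  by apply: contraTneq (galg_mulf_neq0 lenP x0 a0) => y_0; rewrite xayb y_0 mul0r eqxx.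
have {}xayb p : (x * a)@_p = (y * b)@_p by rewrite xayb.
pose P := [seq (g * h)%g | g <- msupp x, h <- msupp a]
  ++ [seq (g * h)%g | g <- msupp y, h <- msupp b].
have [p0 Pp0 max_p0] : exists2 p, p \in P & forall q, q \in P -> (len q <= len p)%N.
  have [g xg] := galg_neq0 x0; have [h ah] := galg_neq0 a0.
  by apply: (seq_argmax _ (x0 := (g * h)%g)); rewrite mem_cat allpairs_f.
pose L := len p0.
have len_xa g h : g \in msupp x -> h \in msupp a -> (len (g * h)%g <= L)%N.
  by move=> xg ah; apply: max_p0; rewrite mem_cat allpairs_f.
have len_yb g h : g \in msupp y -> h \in msupp b -> (len (g * h)%g <= L)%N.
  by move=> yg bh; apply: max_p0; rewrite mem_cat [X in _ || X]allpairs_f ?orbT.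
(* At length [L] factorizations are unique by [len_expand], so nothing cancels there inside [x * a]
   or inside [y * b]. *)
have uniq_top (u v : kG) p g g' :
    (forall g h, g \in msupp u -> h \in msupp v -> (len (g * h)%g <= L)%N) ->
    len p = L -> g \in msupp u -> g' \in msupp u ->
    (g^-1 * p)%g \in msupp v -> (g'^-1 * p)%g \in msupp v -> g' = g.
  move=> len_uv lp ug ug' vg vg'; apply/eqP; rewrite -divg_eq1; apply: contraT => f1.
  have := len_expand lenP p f1; rewrite lp invgF -!mulgA !ltnNge.
  by rewrite !len_uv.
have top_xa p g : len p = L -> g \in msupp x -> (g^-1 * p)%g \in msupp a ->
    (x * a)@_p = x@_g * a@_(g^-1 * p)%g.
  move=> lp xg ag; rewrite -{1}[p](mulVKg g) mcoeffM_uniq // => g' xg'.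
  by rewrite mulVKg; apply: (uniq_top x a).
have top_yb p g : len p = L -> g \in msupp y -> (g^-1 * p)%g \in msupp b ->
    (y * b)@_p = y@_g * b@_(g^-1 * p)%g.
  move=> lp yg bg; rewrite -{1}[p](mulVKg g) mcoeffM_uniq // => g' yg'.
  by rewrite mulVKg; apply: (uniq_top y b).
have [g0 [h0 [xg0 ah0 lgh0]]] : exists g h,
    [/\ g \in msupp x, h \in msupp a & len (g * h)%g = L].
  move: Pp0; rewrite mem_cat => /orP[] /allpairsP[[g h] /= [ug vh p0E]].
    by exists g, h; rewrite -p0E.
  have bg : (g^-1 * p0)%g \in msupp b by rewrite p0E mulKg.
  have : (x * a)@_p0 != 0.
    rewrite xayb (top_yb _ _ (erefl L) ug bg).
    by apply: mulf_neq0; rewrite mcoeff_neq0.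
  by case/mcoeffM_neq0 => g' xg' ah'; exists g', (g'^-1 * p0)%g; rewrite mulVKg.
(* [z] keeps the terms of [y] whose translate of [b] meets the translate of [a] by [g0] at length
   [L]. *)
pose Y0 g := has (fun h => (len (g * h)%g == L) && ((g0^-1 * (g * h))%g \in msupp a)) (msupp b).
have [z mcoeff_z] : exists z : kG, forall p,
    (z * b)@_p = \sum_(g <- msupp y | Y0 g) y@_g * b@_(g^-1 * p)%g.
  exists (\sum_(g <- msupp y | Y0 g) (<< y@_g *g g >> : kG)) => p.
  by rewrite mulr_suml galg_sumE; apply: eq_bigr => g _ /=; apply: mcoeff_galgUl.
pose a1 := (<< x@_g0 *g g0 >> : kG) * a - z * b.
have mcoeff_a1 p : a1@_p = x@_g0 * a@_(g0^-1 * p)%g - (z * b)@_p.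
  by rewrite /a1 galgBE mcoeff_galgUl.
have supp_z p : p \in msupp (z * b) ->
    exists g, [/\ g \in msupp y, Y0 g & (g^-1 * p)%g \in msupp b].
  rewrite -mcoeff_neq0 mcoeff_z => /sum_neq0[g yg /andP[Yg c0]].
  exists g; split=> //; rewrite -mcoeff_neq0.
  by apply: contraNneq c0 => ->; rewrite mulr0.
have supp_a p : p \in msupp ((<< x@_g0 *g g0 >> : kG) * a) -> (g0^-1 * p)%g \in msupp a.
  rewrite -!mcoeff_neq0 mcoeff_galgUl; apply: contraNneq => ->.
  by rewrite mulr0.
have len_le p : p \in msupp a1 -> (len p <= L)%N.
  case/mem_msuppB/orP => [/supp_a ap|/supp_z[g [yg _ bp]]].
    by rewrite -[p](mulVKg g0) len_xa.
  by rewrite -[p](mulVKg g) len_yb.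
have len_lt p : p \in msupp a1 -> (len p < L)%N.
  move=> a1p; rewrite ltn_neqAle len_le // andbT; apply/eqP => lp.
  have [ap|nap] := boolP ((g0^-1 * p)%g \in msupp a).
    have ea : x@_g0 * a@_(g0^-1 * p)%g = (y * b)@_p by rewrite -xayb (top_xa _ _ lp xg0 ap).
    have ez : (z * b)@_p = (y * b)@_p.
      rewrite mcoeff_z (mcoeffM y b p) (bigID Y0 xpredT) /= [X in _ + X]big_seq_cond.
      rewrite [X in _ + X]big1 ?addr0 // => g /andP[yg nYg].
      have [bg|/mcoeff_outdom->] := boolP ((g^-1 * p)%g \in msupp b); last exact: mulr0.
      by case/negP: nYg; apply/hasP; exists (g^-1 * p)%g; rewrite ?mulVKg ?lp ?eqxx.
    by move: a1p; rewrite -mcoeff_neq0 mcoeff_a1 ea ez subrr eqxx.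
  have /supp_z[g [yg /hasP[h bh /andP[/eqP lgh agh]] bp]] : p \in msupp (z * b).
    by case/mem_msuppB/orP: a1p => // /supp_a; rewrite (negPf nap).
  have : (x * a)@_p != 0.
    by rewrite xayb (@top_yb _ g) // mulf_neq0 // mcoeff_neq0.
  case/mcoeffM_neq0 => g1 xg1 ag1.
  (* Here [p] comes from another term [g1] of [x]. By [tree_far] every point of the translate of [a]
     by [g0] is closer to [g * h] than [p] is, hence closer than [diam a]; the four-point condition
     then makes the diameter of [a] too small. *)
  have f1 : (g1 / g0)%g != 1%g.
    by rewrite divg_eq1; apply: contraNneq nap => <-.
  have [r1 [r2 [ar1 ar2 r12]]] := diam_witness len a0.
  have : (dist (g * h)%g (g * (g^-1 * p))%g <= diam a)%N.
    by rewrite dist_mul (leq_trans _ le_ba) // leq_diam.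
  rewrite mulVKg leqNgt => /negP; apply.
  have far r : r \in msupp a -> (dist (g * h)%g (g0 * r)%g < dist (g * h)%g p)%N.
    move=> ar; apply: (tree_far lenP f1 lgh lp).
    - exact: len_xa.
    - by rewrite -mulgA len_xa.
    - by rewrite invgF -mulgA len_xa.
    - by rewrite -mulgA mulKg len_xa.
  have := tree_four_point lenP (g * h)%g (g0 * r1)%g (g0 * r2)%g; rewrite dist_mul r12 lgh.
  have := far _ ar1; have := far _ ar2.
  have := len_xa _ _ xg0 ar1; have := len_xa _ _ xg0 ar2; clear; lia.
have dist_a1 p : p \in msupp a1 -> (dist (g0 * h0)%g p <= diam a)%N.
  case/mem_msuppB/orP => [/supp_a ap|].
    by rewrite -(dist_mul len (g0^-1)%g) mulKg leq_diam.
  case/supp_z => g [yg /hasP[h bh /andP[/eqP lgh agh]] bp].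
  have := tree_four_point lenP (g * h)%g (g0 * h0)%g p; rewrite lgh lgh0.
  have := len_yb _ _ yg bp; rewrite mulVKg.
  have : (dist (g * h)%g p <= diam b)%N by rewrite -(dist_mul len (g^-1)%g) mulKg leq_diam.
  have : (dist (g * h)%g (g0 * h0)%g <= diam a)%N.
    by rewrite -(dist_mul len (g0^-1)%g) mulKg leq_diam.
  move: le_ba; clear; lia.
have dist_lt p q : p \in msupp a1 -> q \in msupp a1 -> (dist p q < diam a)%N.
  move=> a1p a1q; have := tree_four_point lenP (g0 * h0)%g p q; rewrite lgh0.
  have := dist_a1 _ a1p; have := dist_a1 _ a1q.
  have := len_lt _ a1p; have := len_lt _ a1q; clear; lia.
have xg0n : x@_g0 != 0 by rewrite mcoeff_neq0.
pose i := (<< (x@_g0)^-1 *g (g0^-1)%g >> : kG).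
have iK : i * (<< x@_g0 *g g0 >> : kG) = 1 by rewrite galgUM mulVf // mulVg.
exists (i * z); have aE : a - i * z * b = i * a1 by rewrite mulrBr mulrA iK mul1r mulrA.
have [a10|a1n] := eqVneq a1 0.
  by left; apply/eqP; rewrite -subr_eq0 aE a10 mulr0.
right; rewrite aE; apply: leq_ltn_trans (diamUl len _ _ _) _.
have [p [q [a1p a1q <-]]] := diam_witness len a1n.
exact: dist_lt.
Qed.

(* Euclid's algorithm, driven by the diameter. *)
Lemma left_bezout a b x y : a != 0 -> b != 0 -> x != 0 -> x * a = y * b ->
  exists d a' b' s t, [/\ a = a' * d, b = b' * d & d = s * a + t * b].
Proof.
have [n] := ubnP (diam a + diam b); elim: n => // n IH in a b x y *.
move=> lt_n a0 b0 x0 xayb.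
wlog le_ba : a b x y a0 b0 x0 xayb lt_n / (diam b <= diam a)%N.
  move=> wlog_ab; have [le_ba|/ltnW le_ab] := leqP (diam b) (diam a).
    exact: (wlog_ab a b x y).
  have y0 : y != 0.
    by apply: contraTneq (galg_mulf_neq0 lenP x0 a0) => y_0; rewrite xayb y_0 mul0r eqxx.
  have [||d [b' [a' [s [t [bE aE dE]]]]]] // := wlog_ab b a y x b0 a0 y0 _ _ le_ab.
    by rewrite addnC.
  by exists d, a', b', t, s; rewrite addrC.
have [c [aE|lt_a]] := weak_algorithm a0 b0 x0 xayb le_ba.
  by exists b, c, 1, 0, 1; rewrite !mul1r mul0r add0r.
have [a10|a10] := eqVneq (a - c * b) 0.
  by exists b, c, 1, 0, 1; rewrite !mul1r mul0r add0r; move/subr0_eq: a10.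
have [||d [a' [b' [s [t [a1E bE dE]]]]]] // :=
    IH (a - c * b) b x (y - x * c) _ a10 b0 x0 _.
- by rewrite -ltnS; apply: leq_trans lt_n; rewrite ltnS ltn_add2r.
- by rewrite mulrBr mulrBl xayb mulrA.
exists d, (a' + c * b'), b', s, (t - s * c); split=> //.
  by rewrite mulrDl -a1E -mulrA -bE subrK.
by rewrite dE mulrBr mulrBl addrAC addrA mulrA.
Qed.

End WeakAlgorithm.

(** * Extension of scalars to k(s) *)

Lemma fractionP (D : idomainType) (a : {fraction D}) :
  exists n d : D, d != 0 /\ tofrac d * a = tofrac n.
Proof.
pose x := repr a; exists \n_x, \d_x; split; first exact: denom_ratioP.
rewrite -[a]reprK -/x; unlock FracField.tofrac; rewrite -[LHS]FracField.pi_mul.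
apply/eqmodP => /=; rewrite FracField.equivfE /FracField.mulf.
by rewrite !numden_Ratio ?mulf_neq0 ?denom_ratioP ?oner_neq0 // mulr1 !mul1r mulrC.
Qed.

Lemma irreducible_factor (k : fieldType) (d : {poly k}) : (1 < size d)%N ->
  exists2 p : {poly k}, irreducible_poly p & p %| d.
Proof.
have [n] := ubnP (size d); elim: n d => // n IH d; rewrite ltnS => dn d1.
have [[q [q1 qd qnd]]|irr] := boolp.pselect (exists q : {poly k},
    [/\ size q != 1, q %| d & ~~ (q %= d)]).
  have d0 : d != 0 by rewrite -size_poly_gt0; apply: ltnW.
  have q0 : q != 0 by apply: contraNneq d0 => q0; rewrite q0 dvd0p in qd.
  have lt_qd : (size q < size d)%N.
    by rewrite ltn_neqAle dvdp_leq // andbT; move: qnd; rewrite -dvdp_size_eqp.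
  have gt_q : (1 < size q)%N by rewrite ltn_neqAle eq_sym q1 size_poly_gt0.
  have [|p irr_p pq] := IH q _ gt_q; first exact: leq_trans lt_qd dn.
  by exists p => //; apply: dvdp_trans qd.
exists d => //; split=> // q q1 qd; apply/negPn/negP => qnd.
by apply: irr; exists q.
Qed.

Lemma irreducible_prime (k : fieldType) (p a b : {poly k}) : irreducible_poly p ->
  p %| a * b -> p %| a \/ p %| b.
Proof.
move=> irr_p pab; have [pa|npa] := boolP (p %| a); [by left|right].
by move: pab; rewrite Gauss_dvdpr // irreducible_poly_coprime.
Qed.

(** * Gauss's lemma, with [K] the fraction field of k[s] through [j] *)

Section Gauss.
Variables (G : groupType) (len : G -> nat) (k K : fieldType).
Variable j : {rmorphism {poly k} -> K}.
Hypothesis lenP : tree_length len.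
Hypothesis j_inj : injective j.
Hypothesis j_frac : forall a, exists n d, d != 0 /\ j d * a = j n.
Local Notation P := {poly k}.
Local Notation kG := (group_algebra k G).
Local Notation PG := (group_algebra P G).
Local Notation KG := (group_algebra K G).

Definition polyG : kG -> PG := gmap polyC.
Definition fracG : PG -> KG := gmap j.
Definition coefG (i : nat) : PG -> kG := gmap (coefp i).

HB.instance Definition _ := GRing.RMorphism.on polyG.
HB.instance Definition _ := GRing.RMorphism.on fracG.
HB.instance Definition _ i := GRing.Additive.on (coefG i).

Lemma fracG_inj : injective fracG.
Proof. exact: gmap_inj. Qed.

Lemma j_eq0 a : (j a == 0) = (a == 0).
Proof. by rewrite -(inj_eq j_inj) raddf0. Qed.

Lemma polyG_inj : injective polyG.
Proof. by apply: gmap_inj; apply: polyC_inj. Qed.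

Lemma polyGE u g : (polyG u)@_g = (u@_g)%:P.
Proof. exact: mcoeff_gmap. Qed.

Lemma fracGE u g : (fracG u)@_g = j u@_g.
Proof. exact: mcoeff_gmap. Qed.

Lemma coefGE i u g : (coefG i u)@_g = u@_g`_i.
Proof. exact: mcoeff_gmap. Qed.

Lemma polyGU a g : polyG << a *g g >> = << a%:P *g g >>.
Proof. exact: gmapU. Qed.

Lemma coefGU i a g : coefG i << a *g g >> = << a`_i *g g >>.
Proof. exact: gmapU. Qed.

Lemma fracGZ a u : fracG (a *: u) = j a *: fracG u.
Proof. exact: gmapZ. Qed.

Lemma fracGD u v : fracG (u + v) = fracG u + fracG v.
Proof. exact: raddfD. Qed.

Lemma fracGM u v : fracG (u * v) = fracG u * fracG v.
Proof. exact: rmorphM. Qed.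

Lemma polyGM u v : polyG (u * v) = polyG u * polyG v.
Proof. exact: rmorphM. Qed.

Lemma coefGD i u v : coefG i (u + v) = coefG i u + coefG i v.
Proof. exact: raddfD. Qed.

Lemma coefG_mulr i z w : coefG i (z * polyG w) = coefG i z * w.
Proof.
elim/galg_ind: z => [|z z' Hz Hz'|a g].
- by rewrite !(mul0r, raddf0).
- by rewrite !(mulrDl, raddfD) /= Hz Hz'.
elim/galg_ind: w => [|w w' Hw Hw'|b h].
- by rewrite !(raddf0, mulr0).
- by rewrite !(mulrDr, raddfD) /= Hw Hw'.
by rewrite polyGU galgUM !coefGU galgUM coefMC.
Qed.

Lemma coefG_polyG i u : coefG i (polyG u) = if i == 0%N then u else 0.
Proof.
apply/galgP => g; rewrite coefGE polyGE coefC.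
by case: ifP => //; rewrite galg0E.
Qed.

Lemma coefG_polyGX i u : coefG i ('X *: polyG u) = if i == 1%N then u else 0.
Proof.
apply/galgP => g; rewrite coefGE galgZE polyGE coefXM coefC.
by case: i => [|[|i]] //=; rewrite galg0E.
Qed.

Lemma clear_denominators (z : KG) :
  exists d y, d != 0 /\ j d *: z = fracG y.
Proof.
elim/galg_ind: z => [|z z' [d [y [d0 zE]]] [d' [y' [d'0 z'E]]]|a g].
- by exists 1, 0; rewrite oner_neq0 scaler0 raddf0.
- exists (d * d'), (d' *: y + d *: y'); rewrite mulf_neq0 //; split=> //.
  rewrite fracGD !fracGZ -zE -z'E !scalerA scalerDr rmorphM.
  by rewrite [X in X *: z]mulrC.
have [n [d [d0 aE]]] := j_frac a; exists d, << n *g g >>; split=> //.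
by rewrite [LHS]galg_scaleU aE /fracG gmapU.
Qed.

Definition primitive (y : PG) :=
  forall d : P, (forall g, d %| y@_g) -> size d = 1%N.

Lemma galg_divp (d : P) (y : PG) : (forall g, d %| y@_g) -> exists y', y = d *: y'.
Proof.
move=> dy; exists [malg g in msupp y => y@_g %/ d]; apply/galgP => g.
rewrite galgZE mcoeffE; case: ifPn => [_|/mcoeff_outdom ->]; last by rewrite mulr0.
by rewrite mulrC divpK.
Qed.

Lemma primitive_polyG u : u != 0 -> primitive (polyG u).
Proof.
move=> /galg_neq0[g ug] d /(_ g); rewrite polyGE => dg.
rewrite -mcoeff_neq0 in ug.
have c0 : (u@_g)%:P != 0 by rewrite polyC_eq0.
apply/eqP; rewrite eqn_leq size_poly_gt0; apply/andP; split.
  by apply: leq_trans (dvdp_leq c0 dg) _; rewrite size_polyC ug.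
by apply: contraNneq c0 => d0; rewrite d0 dvd0p in dg.
Qed.

(** Taking out a nonconstant common divisor shortens a fixed nonzero coefficient, so the process
    stops. *)
Lemma primitive_part (y : PG) : y != 0 ->
  exists c y', [/\ c != 0, primitive y' & y = c *: y'].
Proof.
move=> /galg_neq0[g]; rewrite -mcoeff_neq0.
have [n] := ubnP (size y@_g); elim: n y => // n IH y; rewrite ltnS => lt_n yg.
have [prim|] := boolp.pselect (primitive y).
  by exists 1, y; rewrite oner_neq0 scale1r.
move=> /boolp.existsNP[d] /boolp.not_implyP[dy] /eqP d1.
have [y' yE] := galg_divp dy; have ygE : y@_g = d * y'@_g by rewrite {1}yE galgZE.
have [d0 y'g] : d != 0 /\ y'@_g != 0.
  by move: yg; rewrite ygE mulf_eq0 negb_or => /andP.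
have [|//|c [y'' [c0 prim y'E]]] := IH y'.
  apply: leq_trans lt_n; rewrite ygE size_mul //.
  have : (size d > 0)%N by rewrite size_poly_gt0.
  have : (size y'@_g > 0)%N by rewrite size_poly_gt0.
  by move: d1; clear; move: (size d) (size y'@_g) => i j; lia.
by exists (d * c), y''; rewrite mulf_neq0 // -scalerA -y'E -yE.
Qed.

(** An irreducible factor [q] of a denominator [d] of [z] divides [z1 * p]; as [p] is primitive,
    Gauss's lemma makes [q] divide [z1], and it cancels from [d]. *)
Lemma gauss_lift (z : KG) (p y : PG) : primitive p -> z * fracG p = fracG y ->
  exists z', z = fracG z'.
Proof.
move=> prim_p zp; have [d [z1 [d0 zE]]] := clear_denominators z.
have [n] := ubnP (size d); elim: n d z1 d0 zE => // n IH d z1 d0 zE; rewrite ltnS => dn.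
have [d1|d1] := leqP (size d) 1.
  have := size1_polyC d1; move: d`_0 => c dE; exists (c^-1%:P *: z1).
  have c0 : c != 0 by move: d0; rewrite dE polyC_eq0.
  rewrite fracGZ -zE scalerA -rmorphM dE -polyCM mulVf //.
  by rewrite rmorph1 scale1r.
have [q irr_q /dvdpP[d' dE]] := irreducible_factor d1.
have q0 := irredp_neq0 irr_q.
have e : z1 * p = d *: y.
  by apply: fracG_inj; rewrite fracGM fracGZ -zp scalerAl zE.
have [| | | | | |qz|qp] := @prime_mcoeff G len P lenP (fun a => q %| a) z1 p.
- exact: dvdp0.
- by move=> a b; apply: dvdp_sub.
- by move=> a b; apply: dvdp_mull.
- by move=> a b; apply: irreducible_prime.
- by move=> a; case: (q %| a); [left|right].
- by move=> g; rewrite e galgZE dE -mulrA dvdp_mull // dvdp_mulr.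
- have [z2 z1E] := galg_divp qz; apply: (IH d' z2).
  + by apply: contraNneq d0 => d'0; rewrite dE d'0 mul0r.
  + have qF : j q != 0 by rewrite j_eq0.
    apply: (scalerI qF); rewrite -fracGZ -z1E -zE scalerA -rmorphM.
    by rewrite dE mulrC.
  + apply: leq_trans dn; rewrite dE size_mul //; last first.
      by apply: contraNneq d0 => d'0; rewrite dE d'0 mul0r.
    have [] := irr_q; clear; move: (size d') (size q); lia.
by have [+ _] := irr_q; rewrite (prim_p _ qp).
Qed.

End Gauss.

Section GaussConstant.
Variables (G : groupType) (len : G -> nat) (k K : fieldType).
Variable j : {rmorphism {poly k} -> K}.
Hypothesis lenP : tree_length len.
Hypothesis j_inj : injective j.
Hypothesis j_frac : forall a, exists n d, d != 0 /\ j d * a = j n.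
Local Notation P := {poly k}.
Local Notation fracG := (@fracG G k K j).
Local Notation kG := (group_algebra k G).
Local Notation PG := (group_algebra P G).
Local Notation KG := (group_algebra K G).

Lemma size_bound (x : PG) : exists n, forall g, (size x@_g <= n)%N.
Proof.
exists (\max_(g <- msupp x) size x@_g)%N => g.
have [xg|/mcoeff_outdom->] := boolP (g \in msupp x); last by rewrite size_poly0.
exact: (leq_bigmax_seq (F := fun g => size x@_g)).
Qed.

(** The terms of top degree in s contain a unique product, so the degrees of [x] and [y] add up in
    one coefficient of [x * y]; hence both are 0. *)
Lemma constant_factor (x y : PG) (v : kG) : v != 0 -> x * y = polyG v ->
  exists y0, y = polyG y0.
Proof.
move=> v0 xy.
have pv0 : polyG v != 0.
  by apply: contraNneq v0 => e; apply/eqP/(@polyG_inj G k); rewrite e raddf0.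
have x0 : x != 0 by apply: contraNneq pv0 => e; rewrite -xy e mul0r.
have y0 : y != 0 by apply: contraNneq pv0 => e; rewrite -xy e mulr0.
have top (z : PG) : z != 0 -> exists2 g, g \in msupp z & forall h, (size z@_h <= size z@_g)%N.
  move=> /galg_neq0[g0 zg0].
  have [g zg gmax] := seq_argmax (fun g => size z@_g) zg0.
  exists g => // h; have [zh|/mcoeff_outdom->] := boolP (h \in msupp z); first exact: gmax.
  by rewrite size_poly0.
have [gx xgx x_max] := top x x0; have [gy ygy y_max] := top y y0.
set m := size x@_gx in x_max; set n := size y@_gy in y_max.
have m0 : (0 < m)%N by rewrite size_poly_gt0 mcoeff_neq0.
have n0 : (0 < n)%N by rewrite size_poly_gt0 mcoeff_neq0.
have Xgx : gx \in [seq g <- msupp x | size x@_g == m] by rewrite mem_filter eqxx.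
have Ygy : gy \in [seq g <- msupp y | size y@_g == n] by rewrite mem_filter eqxx.
have [g [h []]] := uniq_product lenP Xgx Ygy.
rewrite !mem_filter => /andP[/eqP xm xg] /andP[/eqP yn yh] uniq.
(* [size] is the degree plus one: the leading product has size [m + n - 1], and the other
   contributions must stay strictly below. *)
have small : (size (\sum_(g' <- (msupp x `\ g)%fset) x@_g' * y@_(g'^-1 * (g * h))%g)%R
    <= (m + n).-2)%N.
  rewrite big_seq; apply: (big_ind (fun q : P => size q <= (m + n).-2)%N).
  - by rewrite size_poly0.
  - by move=> p q pn qn; rewrite (leq_trans (size_polyD p q)) // geq_max pn.
  move=> g'; rewrite !inE => /andP[g'g xg'].
  set h' := (g'^-1 * _)%g; have := size_polyMleq x@_g' y@_h'.
  have [xm'|xm'] := eqVneq (size x@_g') m; last first.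
    have := x_max g'; have := y_max h'; move: xm' m0 n0; clear.
    move: (size (x@_g' * y@_h')) (size x@_g') (size y@_h') => a b c; lia.
  have yn' : size y@_h' != n.
    apply: contra g'g => /eqP yn'; apply/eqP/(uniq _ h').
    - by rewrite mem_filter xm' eqxx.
    - by rewrite mem_filter yn' eqxx -mcoeff_neq0 -size_poly_gt0 yn'.
    - by rewrite mulVKg.
  have := x_max g'; have := y_max h'; move: yn' m0 n0; clear.
  move: (size (x@_g' * y@_h')) (size x@_g') (size y@_h') => a b c; lia.
have := polyGE v (g * h)%g; rewrite -xy mcoeffM (big_fsetD1 g) //= mulKg => e.
have := size_polyC_leq1 (v@_(g * h)%g); rewrite -e size_polyDl; last first.
  rewrite size_mul -?size_poly_gt0 ?xm ?yn // (leq_ltn_trans small) //.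
  by move: m0 n0; clear; lia.
rewrite size_mul -?size_poly_gt0 ?xm ?yn // => mn1.
have n1 : (n <= 1)%N by move: mn1 m0 n0; clear; lia.
exists (coefG 0 y); apply/galgP => h'; rewrite polyGE coefGE.
by apply: size1_polyC; apply: leq_trans (y_max h') n1.
Qed.

Definition liftG (u : kG) : KG := fracG (polyG u).

HB.instance Definition _ := GRing.RMorphism.copy liftG (fracG \o @polyG G k).

Lemma liftG_inj : injective liftG.
Proof. by move=> u v /(fracG_inj j_inj)/polyG_inj. Qed.

Lemma liftG_eq0 u : (liftG u == 0) = (u == 0).
Proof. by rewrite -(inj_eq liftG_inj) raddf0. Qed.

Lemma liftGM u v : liftG (u * v) = liftG u * liftG v.
Proof. exact: rmorphM. Qed.

(** A scalar of [K] makes [p] primitive over k[s]; [gauss_lift] then puts the cofactor over k[s] as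
    well, and [constant_factor] applies. *)
Lemma gauss_constant (v : kG) (c p : KG) : v != 0 -> liftG v = c * p ->
  exists a p0, [/\ a != 0, p0 != 0 & p = a *: liftG p0].
Proof.
move=> v0 vE; have lv0 : liftG v != 0 by rewrite liftG_eq0.
have p_neq0 : p != 0 by apply: contraNneq lv0 => e; rewrite vE e mulr0.
have [d [y [d0 yE]]] := clear_denominators j_frac p.
have dF : j d != 0 by rewrite (j_eq0 j_inj).
have y0 : y != 0.
  apply: contraNneq p_neq0 => y0; apply/eqP/(scalerI dF).
  by rewrite yE y0 scaler0 raddf0.
have [b [y1 [b0 prim yb]]] := primitive_part y0.
have bF : j b != 0 by rewrite (j_eq0 j_inj).
have [a [a0 aE]] : exists a, a != 0 /\ j d * a = j b.
  exists ((j d)^-1 * j b); rewrite mulVKf //; split=> //.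
  by rewrite mulf_neq0 ?invr_eq0.
have pE : p = a *: fracG y1.
  by apply: (scalerI dF); rewrite yE yb fracGZ scalerA aE.
have [c1 c1E] : exists c1, a *: c = fracG c1.
  apply: (gauss_lift lenP j_inj j_frac prim (y := polyG v)).
  by rewrite -scalerAl scalerAr -pE -vE.
have [p0 y1E] : exists p0, y1 = polyG p0.
  apply: (@constant_factor c1 _ v) => //; apply: (fracG_inj j_inj).
  by rewrite fracGM -c1E -scalerAl scalerAr -pE -vE.
exists a, p0; split=> //.
  by apply: contraNneq p_neq0 => e; rewrite pE y1E e raddf0 raddf0 scaler0.
by rewrite pE y1E.
Qed.

Lemma liftG_divide (p0 : kG) (w : PG) (z : KG) : p0 != 0 ->
  fracG w = z * liftG p0 -> exists2 z', z = fracG z' & w = z' * polyG p0.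
Proof.
move=> p0n wE; have [z' zE] := gauss_lift lenP j_inj j_frac (primitive_polyG p0n) (esym wE).
by exists z' => //; apply: (fracG_inj j_inj); rewrite wE zE fracGM.
Qed.

(* A common right divisor of [v] and [w0 + s w1] over [k(s)] can be taken over
   [k], because it divides the constant [v]. *)
Lemma generic_divisor (v w0 w1 : kG) (x y : KG) :
    let w := fracG (polyG w0 + 'X *: polyG w1) in
    v != 0 -> w != 0 -> x != 0 -> x * liftG v = y * w ->
  exists p a b c s t,
    [/\ v = a * p, w0 = b * p, w1 = c * p & liftG p = s * liftG v + t * w].
Proof.
move=> w v0 w_neq0 x0 xvyw; have lv0 : liftG v != 0 by rewrite liftG_eq0.
have [d [a [b [s [t [vE wE dE]]]]]] := left_bezout lenP lv0 w_neq0 x0 xvyw.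
have [c [p [c0 p0 dp]]] := gauss_constant v0 vE.
have [a' _ vp] : exists2 a', c *: a = fracG a' & polyG v = a' * polyG p.
  by apply: liftG_divide => //; rewrite -scalerAl scalerAr -dp -vE.
have [b' _ wp] : exists2 b', c *: b = fracG b' &
    polyG w0 + 'X *: polyG w1 = b' * polyG p.
  by apply: liftG_divide => //; rewrite -scalerAl scalerAr -dp -wE.
exists p, (coefG 0 a'), (coefG 0 b'), (coefG 1 b'), (c^-1 *: s), (c^-1 *: t).
split; rewrite -?coefG_mulr -?vp -?wp.
- by rewrite coefG_polyG.
- by rewrite coefGD coefG_polyG coefG_polyGX addr0.
- by rewrite coefGD coefG_polyG coefG_polyGX add0r.
by rewrite -!scalerAl -scalerDr -dE dp scalerA mulVf // scale1r.
Qed.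

End GaussConstant.

(** * Relations over k from Bezout identities over k(s) *)

Lemma comm_mulrAC (B : pzRingType) (a b c : B) : GRing.comm b c ->
  a * b * c = a * c * b.
Proof. by move=> bc; rewrite -!mulrA bc. Qed.

(* [B] stands for R[s] with [X = s], [cf i] for the coefficient of s^i, and [C]
   for a localization of [B] at scalar polynomials in s. *)
Section GenericCombination.
Variables (k : fieldType) (R : algType k) (B C : nzRingType).
Variables (pi : {rmorphism R -> B}) (phi : {rmorphism B -> C}) (X : B).
Variables (cst : {poly k} -> B) (cf : nat -> {additive B -> R}).
Hypothesis X_central : forall b, X * b = b * X.
Hypothesis phi_inj : injective phi.
Hypothesis cf_mul : forall i b u, cf i (b * pi u) = cf i b * u.
Hypothesis cf_pi : forall i u, cf i (pi u) = if i == 0%N then u else 0.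
Hypothesis cf_X : forall i b, cf i (X * b) = if i is i'.+1 then cf i' b else 0.
Hypothesis cf_bound : forall b, exists n, forall i, (n <= i)%N -> cf i b = 0.
Hypothesis cf_cst : forall i a, cf i (cst a) = a`_i *: 1.
Hypothesis clear : forall s t, exists (a : {poly k}) (y z : B),
  [/\ a != 0, phi (cst a) * s = phi y & phi (cst a) * t = phi z].
Hypothesis mul_neq0 : forall u v : R, u != 0 -> v != 0 -> u * v != 0.
Hypothesis cancel : forall (u : R) (a b : C), u != 0 ->
  a * phi (pi u) = b * phi (pi u) -> a = b.
Hypothesis divide : forall (u : R) (b : B) (c : C), u != 0 ->
  phi b = c * phi (pi u) -> exists b', b = b' * pi u.
Hypothesis divisor : forall v w0 w1 : R, v != 0 -> w1 != 0 ->
  v * w0 = w0 * v -> v * w1 = w1 * v -> exists p c s t,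
    w1 = c * p /\ phi (pi p) = s * phi (pi v) + t * phi (pi w0 + X * pi w1).
Implicit Types u v w d z : R.

Lemma expr_neq0 v n : v != 0 -> v ^+ n != 0.
Proof. by move=> v0; elim: n => [|n IH]; rewrite ?oner_neq0 // exprS mul_neq0. Qed.

Lemma mul_cancel u v v' : u != 0 -> v * u = v' * u -> v = v'.
Proof.
move=> u0 e; apply/eqP; rewrite -subr_eq0; apply/negPn/negP => n.
by have := mul_neq0 n u0; rewrite mulrBl e subrr eqxx.
Qed.

(* Over k(s) the elements [d] and [u - s] generate the unit left ideal; clearing
   denominators and substituting [u] for [s] gives the relation. *)
Lemma poly_multiple_generic u d : d != 0 -> u * d = d * u ->
  exists (D : {poly k}) (n : nat) (z : R),
    [/\ D != 0, (size D <= n)%N & \sum_(i < n) D`_i *: u ^+ i = z * d].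
Proof.
move=> d0 ud.
have N1 : - 1 != 0 :> R by rewrite oppr_eq0 oner_neq0.
have [|p [c [s [t [cp pE]]]]] := divisor d0 N1 (esym ud); first by rewrite mulrN1 mulN1r.
have unit_eq : 1 = phi (pi (- c)) * s * phi (pi d) +
    phi (pi (- c)) * t * phi (pi u + X * pi (-1)).
  by rewrite -!mulrA -mulrDr -pE -!rmorphM mulNr -cp opprK !rmorph1.
have [D [Y1 [Y2 [D0 Y1E Y2E]]]] := clear (phi (pi (- c)) * s) (phi (pi (- c)) * t).
have eq1 : cst D = Y1 * pi d + Y2 * (pi u + X * pi (-1)).
  apply: phi_inj; rewrite rmorphD !rmorphM -Y1E -Y2E -[LHS]mulr1 [in LHS]unit_eq.
  by rewrite mulrDr !mulrA.
have [n n_bound] := cf_bound Y2.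
exists D, (maxn (size D) n).+1, (\sum_(i < (maxn (size D) n).+1) cf i Y1 * u ^+ i).
split=> //; first by rewrite leqW // leq_maxl.
(* [f i] is the coefficient of s^i in [Y2 * (u - s)]. Substituting [u] to the right of the
   coefficients telescopes these to a boundary term, which vanishes beyond the degree of [Y2]; the
   part [Y1 * d] keeps its right factor [d] because [d] commutes with [u]. *)
pose f i := cf i Y2 * u - (if i is i'.+1 then cf i' Y2 else 0).
have coef_eq i : D`_i *: 1 = cf i Y1 * d + f i.
  rewrite -cf_cst eq1 raddfD cf_mul /= mulrDr raddfD /= cf_mul; congr (_ + (_ + _)).
  rewrite mulrA -X_central -mulrA cf_X; case: i => [|i]; rewrite ?oppr0 //.
  by rewrite cf_mul mulrN1.
have tele M : \sum_(i < M.+1) f i * u ^+ i = cf M Y2 * u ^+ M.+1.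
  elim: M => [|M IH]; first by rewrite big_ord1 /f subr0 expr0 mulr1 expr1.
  by rewrite big_ord_recr IH /= mulrBl -mulrA -exprS addrC subrK.
rewrite mulr_suml (eq_bigr (fun i : 'I__ => cf i Y1 * u ^+ i * d + f i * u ^+ i)).
  by rewrite big_split /= tele n_bound ?leq_maxr // mul0r addr0.
move=> i _; rewrite -[u ^+ i]mul1r scalerAl coef_eq mulrDl mul1r.
by congr (_ + _); apply: comm_mulrAC; apply: commrX; apply: esym.
Qed.

(* [(w - s v) E = w^n - s^n v^n], and the coefficient of s^(n-2) in [E] is
   [w v^(n-2)]. *)
Lemma root_divisible_generic v w z n : v != 0 -> v * w = w * v ->
  w ^+ n.+1 = z * v ^+ n.+1 -> exists x, w = x * v.
Proof.
case: n => [|m]; first by rewrite !expr1 => _ _ ->; exists z.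
set n := m.+2 => v0 vw wn.
have vN0 : - v != 0 by rewrite oppr_eq0.
have c_vw i : GRing.comm (v ^+ i) w by apply/commr_sym/commrX/commr_sym.
have c_vv i : GRing.comm (v ^+ i) v by apply/commr_sym/commrX.
have [|p [c [s [t [cp pE]]]]] := divisor (expr_neq0 n v0) vN0 (c_vw n).
  by rewrite mulrN mulNr c_vv.
set W := pi w + X * pi (- v) in pE.
have {c cp p pE} [S [T vE]] : exists S T,
    phi (pi v) = S * phi (pi (v ^+ n)) + T * phi W.
  exists (phi (pi (- c)) * s), (phi (pi (- c)) * t).
  by rewrite -!mulrA -mulrDr -pE -!rmorphM mulNr -cp opprK.
have c_Xpi u : GRing.comm X (pi u) by rewrite /GRing.comm X_central.
pose E := \sum_(i < n) pi w ^+ (n.-1 - i) * (X * pi v) ^+ i.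
have EE : E = \sum_(i < n) X ^+ i * pi (w ^+ (n.-1 - i) * v ^+ i).
  apply: eq_bigr => i _; rewrite exprMn_comm // rmorphM !rmorphXn [RHS]mulrA.
  rewrite mulrA; congr (_ * _); apply: commrX; apply: commr_sym; apply: commrX.
  exact: c_Xpi.
have WEE : W * E = (pi z - X ^+ n) * pi (v ^+ n).
  have -> : W = pi w - X * pi v by rewrite /W rmorphN mulrN.
  have xy : GRing.comm (pi w) (X * pi v).
    by rewrite /GRing.comm mulrA -X_central -!mulrA -!rmorphM vw.
  by rewrite -subrXX_comm // exprMn_comm // mulrBl -rmorphM -wn !rmorphXn.
have EC u : v * u = u * v -> w * u = u * w -> E * pi u = pi u * E.
  move=> vu wu; apply: commr_sym; rewrite EE; apply: commr_sum => i _.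
  apply: commrM; first by apply/commrX/commr_sym.
  rewrite /GRing.comm -!rmorphM; congr (pi _).
  by apply: commrM; apply: commrX; apply: esym.
(* [E] commutes with [v], so [E v = (S v^n + T W) E], and [W E] is a left multiple of [v^n] by the
   assumption on [w^n]. *)
have [Q QE] : exists Q, phi E * phi (pi v) = Q * phi (pi (v ^+ n)).
  exists (S * phi E + T * phi (pi z - X ^+ n)).
  rewrite -rmorphM (EC v erefl (esym vw)) rmorphM vE !mulrDl -!mulrA -!rmorphM WEE.
  by rewrite (EC _ (esym (c_vv n)) (esym (c_vw n))).
have {Q QE} [E' EE'] : exists b, E = b * pi (v ^+ m.+1).
  apply: (divide (c := Q) (expr_neq0 _ v0)); apply: (cancel v0).
  by rewrite QE -mulrA -!rmorphM -exprSr.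
have cf_Xn i l u : cf l (X ^+ i * pi u) = if l == i then u else 0.
  elim: i l => [|i IH] l; first by rewrite mul1r cf_pi.
  by rewrite exprS -mulrA cf_X; case: l => [|l] //=; rewrite IH eqSS.
have : cf m E = w * v ^+ m.
  rewrite EE raddf_sum (bigD1 (Ordinal (ltnW (leqnn n)))) //= big1 ?addr0.
    by rewrite cf_Xn eqxx subSnn expr1.
  move=> [i lt_in] /=; rewrite -val_eqE /= cf_Xn => ne.
  by rewrite eq_sym (negPf ne).
rewrite EE' cf_mul exprS mulrA => /(mul_cancel (expr_neq0 m v0)) <-.
by exists (cf m E').
Qed.

End GenericCombination.

Section GenericInstance.
Variables (G : groupType) (len : G -> nat) (k K : fieldType).
Variable j : {rmorphism {poly k} -> K}.
Hypothesis lenP : tree_length len.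
Hypothesis j_inj : injective j.
Hypothesis j_frac : forall a, exists n d, d != 0 /\ j d * a = j n.
Local Notation P := {poly k}.
Local Notation kG := (group_algebra k G).
Local Notation PG := (group_algebra P G).
Local Notation KG := (group_algebra K G).
Local Notation fracG := (@fracG G k K j).
Local Notation liftG := (@liftG G k K j).
Implicit Types (u v w d z : kG).

Definition varG : PG := 'X *: 1.
Definition cstG (a : P) : PG := a *: 1.

Lemma varG_mul (b : PG) : varG * b = 'X *: b.
Proof. by rewrite /varG -scalerAl mul1r. Qed.

Lemma varG_central (b : PG) : varG * b = b * varG.
Proof. by rewrite varG_mul /varG -scalerAr mulr1. Qed.

Lemma coefG_varG i (b : PG) :
  coefG i (varG * b) = if i is i'.+1 then coefG i' b else 0.
Proof.
apply/galgP => g; rewrite varG_mul coefGE galgZE coefXM.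
by case: i => [|i]; rewrite ?galg0E ?coefGE.
Qed.

Lemma coefG_bound (b : PG) : exists n, forall i, (n <= i)%N -> coefG i b = 0.
Proof.
have [n bn] := size_bound b; exists n => i ni; apply/galgP => g.
by rewrite coefGE galg0E nth_default // (leq_trans (bn g)).
Qed.

Lemma coefG_cstG i a : coefG i (cstG a) = a`_i *: (1 : kG).
Proof.
apply/galgP => g; rewrite coefGE !galgZE -[1](rmorph1 (@polyG G k)) polyGE.
by rewrite coefMC.
Qed.

Lemma clear_denominators2 (s t : KG) : exists a (y z : PG),
  [/\ a != 0, fracG (cstG a) * s = fracG y & fracG (cstG a) * t = fracG z].
Proof.
have [a [y [a0 sE]]] := clear_denominators j_frac s.
have [b [z [b0 tE]]] := clear_denominators j_frac t.
have cst_mul c (u : KG) : fracG (cstG c) * u = j c *: u.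
  by rewrite /cstG fracGZ -scalerAl [fracG 1](rmorph1 fracG) mul1r.
exists (a * b), (b *: y), (a *: z); split; first by rewrite mulf_neq0.
  by rewrite cst_mul fracGZ -sE scalerA -rmorphM [b * a]mulrC.
by rewrite cst_mul fracGZ -tE scalerA -rmorphM.
Qed.

Lemma liftG_cancel u (a b : KG) : u != 0 ->
  a * fracG (polyG u) = b * fracG (polyG u) -> a = b.
Proof. by move=> u0; apply: (galg_mulIf lenP); rewrite (liftG_eq0 j_inj). Qed.

Lemma liftG_dividel u (b : PG) (c : KG) : u != 0 ->
  fracG b = c * fracG (polyG u) -> exists b', b = b' * polyG u.
Proof.
by move=> u0 bE; have [b' _ ->] := liftG_divide lenP j_inj j_frac u0 bE; exists b'.
Qed.

(** Commutation supplies the common left multiple [W * v = v * W], with W the generic combination,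
    on which the Bezout relation depends. *)
Lemma liftG_divisor v w0 w1 : v != 0 -> w1 != 0 ->
  v * w0 = w0 * v -> v * w1 = w1 * v -> exists p c s t,
    w1 = c * p /\ fracG (polyG p) =
      s * fracG (polyG v) + t * fracG (polyG w0 + varG * polyG w1).
Proof.
move=> v0 w10 e0 e1; rewrite varG_mul.
have W0 : fracG (polyG w0 + 'X *: polyG w1) != 0.
  apply: contraNneq w10 => e; have : polyG w0 + 'X *: polyG w1 = 0.
    by apply: (fracG_inj j_inj); rewrite e raddf0.
  move/(congr1 (coefG 1)); rewrite coefGD coefG_polyG coefG_polyGX add0r => ->.
  by rewrite raddf0.
have [|p [a [b [c [s [t [_ _ cp pE]]]]]]] :=
    generic_divisor lenP j_inj j_frac v0 W0 W0 (y := liftG v); last first.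
  by exists p, c, s, t.
rewrite -!fracGM; congr (fracG _).
by rewrite mulrDl mulrDr -scalerAl -scalerAr -!polyGM e0 e1.
Qed.

End GenericInstance.

Section PolynomialRelations.
Variables (G : groupType) (len : G -> nat) (k : fieldType).
Hypothesis lenP : tree_length len.
Local Notation kG := (group_algebra k G).
Implicit Types (u v w d z : kG).

Lemma poly_multiple u d : d != 0 -> u * d = d * u ->
  exists (D : {poly k}) (n : nat) (z : kG),
    [/\ D != 0, (size D <= n)%N & \sum_(i < n) D`_i *: u ^+ i = z * d].
Proof.
pose j := @FracField.tofrac {poly k}.
have j_inj : injective j by move=> a b /eqP; rewrite tofrac_eq => /eqP.
have j_frac := @fractionP {poly k}.
apply: (poly_multiple_generic (pi := @polyG G k) (phi := fracG j) (X := varG G k)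
  (cst := @cstG G k) (cf := @coefG G k)).
- exact: varG_central.
- exact: fracG_inj.
- exact: coefG_mulr.
- exact: coefG_varG.
- exact: coefG_bound.
- exact: coefG_cstG.
- exact: (clear_denominators2 j_frac).
- exact: (liftG_divisor lenP j_inj j_frac).
Qed.

Lemma root_divisible v w z n : v != 0 -> v * w = w * v ->
  w ^+ n.+1 = z * v ^+ n.+1 -> exists x, w = x * v.
Proof.
pose j := @FracField.tofrac {poly k}.
have j_inj : injective j by move=> a b /eqP; rewrite tofrac_eq => /eqP.
have j_frac := @fractionP {poly k}.
apply: (root_divisible_generic (pi := @polyG G k) (phi := fracG j) (X := varG G k)
  (cf := @coefG G k)).
- exact: varG_central.
- exact: coefG_mulr.
- exact: coefG_polyG.
- exact: coefG_varG.
- exact: (galg_mulf_neq0 lenP).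
- exact: (liftG_cancel lenP j_inj).
- exact: (liftG_dividel lenP j_inj j_frac).
- exact: (liftG_divisor lenP j_inj j_frac).
Qed.

End PolynomialRelations.

(** * Graded centralizers *)

Section Grading.
Variables (G : groupType) (R : realDomainType) (k : comNzRingType) (h : G -> R).
Hypothesis hM : {morph h : x y / (x * y)%g >-> x + y}.
Local Notation kG := (group_algebra k G).
Implicit Types (u v w : kG) (a b c : R).

(** Unlike [homogeneous], this admits 0 in every degree, so each degree is a linear subspace. *)
Definition graded b v := forall g, h g != b -> v@_g = 0.

Definition hproj b v : kG := [malg g in msupp v => if h g == b then v@_g else 0].

Lemma hprojE b v g : (hproj b v)@_g = if h g == b then v@_g else 0.
Proof.
rewrite /hproj mcoeffE; case: ifPn => // /mcoeff_outdom ->.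
by rewrite if_same.
Qed.

Lemma hproj_graded b v : graded b (hproj b v).
Proof. by move=> g /negPf gb; rewrite hprojE gb. Qed.

Lemma hproj_additive b : {morph hproj b : u v / u - v}.
Proof.
move=> u v; apply/galgP => g; rewrite !(hprojE, galgBE).
by case: ifP; rewrite ?subr0.
Qed.

HB.instance Definition _ b :=
  GRing.isZmodMorphism.Build kG kG (hproj b) (hproj_additive b).

Lemma hprojZ b (x : k) v : hproj b (x *: v) = x *: hproj b v.
Proof.
by apply/galgP => g; rewrite !(hprojE, galgZE); case: ifP; rewrite ?mulr0.
Qed.

Lemma hproj_id b c v : graded b v -> hproj c v = if c == b then v else 0.
Proof.
move=> bv; apply/galgP => g; rewrite hprojE.
have [->|cb] := eqVneq c b; last first.
  by rewrite galg0E; case: eqP => // gc; apply: bv; rewrite gc.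
by case: (eqVneq (h g) b) => // /bv->.
Qed.

Lemma hproj_sum v : v = \sum_(b <- undup [seq h g | g <- msupp v]) hproj b v.
Proof.
apply/galgP => g; rewrite galg_sumE.
have [gv|gv] := boolP (g \in msupp v); last first.
  by rewrite big1 ?mcoeff_outdom // => b _; rewrite hprojE mcoeff_outdom // if_same.
rewrite (bigD1_seq (h g)) ?undup_uniq ?mem_undup ?map_f //= hprojE eqxx big1 ?addr0 //.
by move=> b; rewrite hprojE eq_sym => /negPf->.
Qed.

Lemma h1 : h 1%g = 0.
Proof. by apply: (addrI (h 1%g)); rewrite -hM mulg1 addr0. Qed.

Lemma hV g : h (g^-1)%g = - h g.
Proof. by apply: (addrI (h g)); rewrite -hM mulgV h1 subrr. Qed.

Lemma gradedD b u v : graded b u -> graded b v -> graded b (u + v).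
Proof. by move=> bu bv g gb; rewrite galgDE bu // bv // addr0. Qed.

Lemma gradedZ b (x : k) v : graded b v -> graded b (x *: v).
Proof. by move=> bv g gb; rewrite galgZE bv // mulr0. Qed.

Lemma graded1 : graded 0 1.
Proof.
move=> g; rewrite mcoeff_galg1; have [->|//] := eqVneq g 1%g.
by rewrite h1 eqxx.
Qed.

Lemma gradedU g (x : k) : graded (h g) (<< x *g g >> : kG).
Proof. by move=> p pg; rewrite mcoeffU; have [e|//] := eqVneq g p; rewrite e eqxx in pg. Qed.

Lemma gradedM b c u v : graded b u -> graded c v -> graded (b + c) (u * v).
Proof.
move=> bu cv g gbc; rewrite mcoeffM big1 // => p _.
have [pb|pb] := eqVneq (h p) b; last by rewrite bu ?mul0r.
rewrite cv ?mulr0 //; apply: contraNneq gbc => e.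
by rewrite -e hM hV pb addrA subrr add0r.
Qed.

Lemma gradedX b n u : graded b u -> graded (b *+ n) (u ^+ n).
Proof.
move=> bu; elim: n => [|n IH]; first exact: graded1.
by rewrite mulrS exprS; apply: gradedM.
Qed.

Lemma graded_inj b c v : v != 0 -> graded b v -> graded c v -> b = c.
Proof.
move=> /galg_neq0[g]; rewrite -mcoeff_neq0 => gv bv cv.
have eq_h d : graded d v -> h g = d.
  by move=> dv; apply/eqP; apply: contraNT gv => /dv->.
by rewrite -(eq_h b bv) -(eq_h c cv).
Qed.

Lemma hprojMl b c u v : graded c v -> hproj b (u * v) = hproj (b - c) u * v.
Proof.
move=> cv; suff key s : hproj b ((\sum_(d <- s) hproj d u) * v) =
    hproj (b - c) (\sum_(d <- s) hproj d u) * v.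
  by have := key (undup [seq h g | g <- msupp u]); rewrite -hproj_sum.
rewrite mulr_suml !raddf_sum /= mulr_suml; apply: eq_bigr => d _.
rewrite (hproj_id b (gradedM (hproj_graded (b := d) u) cv)).
rewrite (hproj_id _ (hproj_graded (b := d) u)) subr_eq.
by case: ifP => //; rewrite mul0r.
Qed.

Lemma hprojMr b c u v : graded c v -> hproj b (v * u) = v * hproj (b - c) u.
Proof.
move=> cv; suff key s : hproj b (v * \sum_(d <- s) hproj d u) =
    v * hproj (b - c) (\sum_(d <- s) hproj d u).
  by have := key (undup [seq h g | g <- msupp u]); rewrite -hproj_sum.
rewrite mulr_sumr !raddf_sum /= mulr_sumr; apply: eq_bigr => d _.
rewrite (hproj_id b (gradedM cv (hproj_graded (b := d) u))).
rewrite (hproj_id _ (hproj_graded (b := d) u)) subr_eq addrC.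
by case: ifP => //; rewrite mulr0.
Qed.

Lemma hproj_comm a b u v : graded a u -> u * v = v * u ->
  u * hproj b v = hproj b v * u.
Proof.
move=> au uv; have := congr1 (hproj (b + a)) uv.
by rewrite (hprojMr _ _ au) (hprojMl _ _ au) addrK.
Qed.

Lemma hproj_neq0 v : v != 0 -> exists b, hproj b v != 0.
Proof.
move=> /galg_neq0[g]; rewrite -mcoeff_neq0 => gv; exists (h g).
by apply: contraNneq gv => e; have := hprojE (h g) v g; rewrite e eqxx galg0E => <-.
Qed.

(* A nonzero element has finitely many degrees, so every chain of step [b]
   starting inside its set of degrees leaves it. *)
Lemma degree_chain b c v : b != 0 -> hproj c v != 0 ->
  exists m, hproj (c + b *+ m) v != 0 /\ hproj (c + b *+ m.+1) v = 0.
Proof.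
move=> b0 cv; have ex0 : exists m, hproj (c + b *+ m) v == 0.
  apply: contrapT => n0; pose N := (#|` msupp v|).+1.
  have : (N <= size [seq h g | g <- msupp v])%N.
    rewrite -[N](size_iota 0) -(size_map (fun m => c + b *+ m)); apply: uniq_leq_size.
      by rewrite map_inj_uniq ?iota_uniq // => m n /addrI/(mulrIn b0).
    move=> _ /mapP[m _ ->]; have : hproj (c + b *+ m) v != 0.
      by apply/negP => e; apply: n0; exists m.
    move=> /galg_neq0[g]; rewrite -mcoeff_neq0 hprojE.
    have [<-|_] := eqVneq (h g) _; last by rewrite eqxx.
    by rewrite mcoeff_neq0 => gv; apply: map_f.
  by rewrite size_map ltnn.
have [[|m] + m_min] := ex_minnP ex0; first by rewrite mulr0n addr0 (negPf cv).
move=> /eqP z; exists m; split=> //.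
by apply/negP => /m_min; rewrite ltnn.
Qed.

End Grading.

(** * Degrees of elements commuting with a homogeneous element *)

Section HomogeneousRelations.
Variables (G : groupType) (len : G -> nat) (R : realDomainType) (k : fieldType).
Variable h : G -> R.
Hypothesis lenP : tree_length len.
Hypothesis hM : {morph h : x y / (x * y)%g >-> x + y}.
Local Notation kG := (group_algebra k G).
Implicit Types (u v z : kG) (D : {poly k}) (a b c : R).

Lemma hproj_poly a i n D u : a != 0 -> graded h a u ->
  hproj h (a *+ i) (\sum_(l < n) D`_l *: u ^+ l) = if (i < n)%N then D`_i *: u ^+ i else 0.
Proof.
move=> a0 au; have proj l : hproj h (a *+ i) (D`_l *: u ^+ l) =
    if i == l then D`_l *: u ^+ l else 0.
  rewrite hprojZ (hproj_id _ (gradedX hM au)) (inj_eq (mulrIn a0)).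
  by case: ifP => //; rewrite scaler0.
rewrite raddf_sum /=; case: ifPn => lt_in.
  rewrite (bigD1 (Ordinal lt_in)) //= big1 ?addr0 ?proj ?eqxx // => l li.
  by rewrite proj eq_sym; move: li; rewrite -val_eqE => /negPf->.
rewrite big1 // => l _; rewrite proj; case: eqP => // e.
by rewrite e ltn_ord in lt_in.
Qed.

Lemma hproj_poly_degree a c n D u : graded h a u ->
  hproj h c (\sum_(l < n) D`_l *: u ^+ l) != 0 -> exists i, c = a *+ i.
Proof.
move=> au; rewrite raddf_sum /= => /sum_neq0[i _ /andP[_]].
rewrite hprojZ (hproj_id _ (gradedX hM au)).
have [-> _|_] := eqVneq c; first by exists i.
by rewrite scaler0 eqxx.
Qed.

(** Since [a != 0], the powers of [u] have distinct degrees, and projecting the relation of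
    [poly_multiple] to the degree of its leading term isolates one power of [u]. *)
Lemma power_multiple a b u v : a != 0 -> u != 0 -> graded h a u ->
  v != 0 -> graded h b v -> u * v = v * u -> exists i z, u ^+ i = z * v.
Proof.
move=> a0 u0 au v0 bv uv.
have [D [n [z [D0 Dn zE]]]] := poly_multiple lenP v0 uv.
pose i := (size D).-1; have Di : D`_i != 0 by rewrite -lead_coefE lead_coef_eq0.
have lt_in : (i < n)%N by move: Dn D0; rewrite -size_poly_gt0 /i; clear; lia.
have := hproj_poly i n D a0 au; rewrite lt_in zE (hprojMl hM _ _ bv) => e.
exists i, ((D`_i)^-1 *: hproj h (a *+ i - b) z).
by rewrite -scalerAl e scalerA mulVf // scale1r.
Qed.

(** [poly_multiple] is applied to the inhomogeneous [v - 1]. The degrees of [z * (v - 1)], a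
    polynomial in [u], are multiples of [a]. Along a chain of step [b] in the degrees of [z], the
    top one shifted by [b] and the bottom one itself survive in this product, and they differ by a
    positive multiple of [b]. *)
Lemma commensurable a b u v : a != 0 -> u != 0 -> graded h a u ->
  b != 0 -> v != 0 -> graded h b v -> u * v = v * u ->
  exists n i i', (0 < n)%N /\ b *+ n + a *+ i' = a *+ i.
Proof.
move=> a0 u0 au b0 v0 bv uv.
have v10 : v - 1 != 0.
  apply: contra_neq b0 => /subr0_eq v1; rewrite v1 in bv.
  by apply: (graded_inj (oner_neq0 _) bv); apply: graded1.
have uv1 : u * (v - 1) = (v - 1) * u by rewrite mulrBl mulrBr uv mulr1 mul1r.
have [D [n [z [D0 Dn zE]]]] := poly_multiple lenP v10 uv1.
have z0 : z != 0.
  pose i := (size D).-1; have Di : D`_i != 0 by rewrite -lead_coefE lead_coef_eq0.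
  have lt_in : (i < n)%N by move: Dn D0; rewrite -size_poly_gt0 /i; clear; lia.
  apply/eqP => z0; have := hproj_poly i n D a0 au; rewrite lt_in zE z0 mul0r raddf0.
  move=> e; have : D`_i *: u ^+ i != 0 by rewrite scaler_eq0 negb_or Di (galg_expf_neq0 lenP).
  by rewrite -e eqxx.
have key c : hproj h (c - b) z * v - hproj h c z != 0 -> exists i, c = a *+ i.
  have -> : hproj h (c - b) z * v - hproj h c z = hproj h c (z * (v - 1)).
    by rewrite mulrBr mulr1 raddfB /= (hprojMl hM _ _ bv).
  by rewrite -zE; apply: hproj_poly_degree.
have [c cz] := hproj_neq0 h z0.
have [m [mz m1z]] := degree_chain b0 cz.
have [|m' [m'z m'1z]] := degree_chain (b := - b) _ cz; first by rewrite oppr_eq0.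
have [|i iE] := key (c + b *+ m.+1).
  rewrite m1z subr0 mulrSr addrA addrK; exact: (galg_mulf_neq0 lenP).
have [|i' i'E] := key (c + (- b) *+ m').
  by move: m'1z; rewrite mulrSr addrA => ->; rewrite mul0r sub0r oppr_eq0.
exists (m' + m.+1)%N, i, i'; split; first by rewrite addnS.
by rewrite -iE -i'E mulrnDr mulNrn [LHS]addrC addrA subrK.
Qed.

End HomogeneousRelations.

Section OneDimensional.
Variables (G : groupType) (len : G -> nat) (R : realDomainType) (k K : fieldType).
Variable j : {rmorphism {poly k} -> K}.
Variable h : G -> R.
Hypothesis lenP : tree_length len.
Hypothesis hM : {morph h : x y / (x * y)%g >-> x + y}.
Hypothesis j_inj : injective j.
Hypothesis j_frac : forall a, exists n d, d != 0 /\ j d * a = j n.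
Local Notation kG := (group_algebra k G).
Local Notation liftG := (@liftG G k K j).
Implicit Types (u v : kG) (a b : R).

Lemma liftG_graded b v : graded h b v -> graded h b (liftG v).
Proof. by move=> bv g gb; rewrite fracGE polyGE bv // !rmorph0. Qed.

(* Homogeneity is preserved by the generic combination [v + s v'], so some power
   of [u] is a multiple of it over [k(s)]; by Gauss's lemma [v + s v'] is then
   proportional to an element [p] with coefficients in [k]. *)
Lemma proportional_generic a b u v v' : a != 0 -> u != 0 -> graded h a u ->
    graded h b v -> graded h b v' -> u * v = v * u -> u * v' = v' * u ->
  v != 0 -> exists x, v' = x *: v.
Proof.
move=> a0 u0 au bv bv' uv uv' v0.
pose w := liftG v + j 'X *: liftG v'.
have wE g : w@_g = j ((v@_g)%:P + 'X * (v'@_g)%:P).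
  by rewrite galgDE galgZE !fracGE !polyGE rmorphD rmorphM.
have bw : graded h b w by apply: gradedD; [|apply: gradedZ]; apply: liftG_graded.
have uw : liftG u * w = w * liftG u.
  by rewrite mulrDr mulrDl -scalerAr -scalerAl -!liftGM uv uv'.
have w0 : w != 0.
  apply: contraNneq v0 => e; apply/eqP/galgP => g; have := wE g.
  rewrite e !galg0E => /esym/eqP; rewrite (j_eq0 j_inj) => /eqP/(congr1 (coefp 0)).
  by rewrite /= coefD coefXM coefC !coef0 addr0.
have lu0 : liftG u != 0 by rewrite (liftG_eq0 j_inj).
have [i [z zE]] := power_multiple lenP hM a0 lu0 (liftG_graded au) w0 bw uw.
have ui0 : u ^+ i != 0 by apply: (galg_expf_neq0 lenP).
have lui : liftG (u ^+ i) = z * w by rewrite -zE; apply: (rmorphXn liftG).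
have [x [p [x0 p0 wp]]] := gauss_constant lenP j_inj j_frac ui0 lui.
have [g0 pg0] := galg_neq0 p0; rewrite -mcoeff_neq0 in pg0.
(* The factor [x] relating [w] to [p] is read off at the single coefficient [g0]: it is
   [al + s be]. *)
pose al := v@_g0 / p@_g0; pose be := v'@_g0 / p@_g0.
have jp : j (p@_g0)%:P != 0 by rewrite (j_eq0 j_inj) polyC_eq0.
have coef g : (v@_g)%:P + 'X * (v'@_g)%:P = (al%:P + 'X * be%:P) * (p@_g)%:P.
  apply: j_inj; rewrite -wE wp galgZE fracGE polyGE rmorphM; congr (_ * _).
  apply: (mulIf jp); rewrite -rmorphM mulrDl -mulrA -!polyCM !divfK //.
  by rewrite -wE wp galgZE fracGE polyGE.
have vp : v = al *: p.
  apply/galgP => g; have := congr1 (coefp 0) (coef g).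
  by rewrite /= mulrDl -mulrA -!polyCM !coefD !coefXM !coefC /= !addr0 galgZE.
have v'p : v' = be *: p.
  apply/galgP => g; have := congr1 (coefp 1) (coef g).
  by rewrite /= mulrDl -mulrA -!polyCM !coefD !coefXM !coefC /= !add0r galgZE.
have al0 : al != 0 by apply: contraNneq v0 => e; rewrite vp e scale0r.
by exists (be / al); rewrite vp scalerA divfK.
Qed.

End OneDimensional.

Lemma proportional (G : groupType) (len : G -> nat) (R : realDomainType)
    (k : fieldType) (h : G -> R) (a b : R) (u v v' : group_algebra k G) :
    tree_length len -> {morph h : x y / (x * y)%g >-> x + y} ->
    a != 0 -> u != 0 -> graded h a u -> graded h b v -> graded h b v' ->
  u * v = v * u -> u * v' = v' * u -> v != 0 -> exists x, v' = x *: v.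
Proof.
move=> lenP hM.
have j_inj : injective (@FracField.tofrac {poly k}).
  by move=> x y /eqP; rewrite tofrac_eq => /eqP.
exact: (proportional_generic lenP hM j_inj (@fractionP {poly k})).
Qed.

Lemma coprime_expf (k : fieldType) (x : k) p q : (0 < p)%N -> coprime p q ->
  x ^+ p = 1 -> x ^+ q = 1 -> x = 1.
Proof.
move=> p0 /eqP pq xp xq; have [km kn e _] := egcdnP q p0.
have : x ^+ (km * p) = 1 by rewrite mulnC exprM xp expr1n.
by rewrite e pq addn1 exprS mulnC exprM xq expr1n mulr1.
Qed.

Section QuasiCommute.
Variables (k : fieldType) (B : algType k).
Implicit Types (v w : B) (x : k).

Lemma scale_comm_Xl v w x n : w * v = x *: (v * w) -> w ^+ n * v = x ^+ n *: (v * w ^+ n).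
Proof.
move=> wv; elim: n => [|n IH]; first by rewrite scale1r mulr1 mul1r.
rewrite exprSr -mulrA wv -scalerAr [w ^+ n * (v * w)]mulrA IH -scalerAl scalerA -exprS.
by rewrite -mulrA.
Qed.

Lemma scale_comm_Xr v w x n : w * v = x *: (v * w) -> w * v ^+ n = x ^+ n *: (v ^+ n * w).
Proof.
move=> wv; elim: n => [|n IH]; first by rewrite scale1r mulr1 mul1r.
rewrite exprS [w * _]mulrA wv -scalerAl -[v * w * _]mulrA IH -scalerAr scalerA.
by rewrite mulrA -!exprS.
Qed.

End QuasiCommute.

(** * Homogeneous elements of the centralizer *)

Section GradedCentralizer.
Variables (G : groupType) (len : G -> nat) (R : realDomainType) (k : fieldType).
Variable h : G -> R.
Hypothesis lenP : tree_length len.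
Hypothesis hM : {morph h : x y / (x * y)%g >-> x + y}.
Local Notation kG := (group_algebra k G).
Variables (a : R) (u : kG).
Hypothesis a_gt0 : 0 < a.
Hypothesis u0 : u != 0.
Hypothesis au : graded h a u.
Hypothesis u_nonmonomial : ~~ monomial u.
Implicit Types (v w t x y : kG) (b c : R) (l : k).

Definition hcent b v := [/\ v != 0, graded h b v & u * v = v * u].

Lemma hcentM b c v w : hcent b v -> hcent c w -> hcent (b + c) (v * w).
Proof.
move=> [v0 bv uv] [w0 cw uw]; split; first exact: (galg_mulf_neq0 lenP).
  exact: gradedM.
by rewrite mulrA uv -mulrA uw mulrA.
Qed.

Lemma hcent1 : hcent 0 1.
Proof. by split; [exact: oner_neq0 | exact: graded1 | rewrite mulr1 mul1r]. Qed.

Lemma hcentX b v n : hcent b v -> hcent (b *+ n) (v ^+ n).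
Proof.
move=> bv; elim: n => [|n IH]; first exact: hcent1.
by rewrite mulrS exprS; apply: hcentM.
Qed.

Lemma hcentu : hcent a u.
Proof. by split. Qed.

Lemma hcentZ b l v : l != 0 -> hcent b v -> hcent b (l *: v).
Proof.
move=> l0 [v0 bv uv]; split; first by rewrite scaler_eq0 negb_or l0.
  exact: gradedZ.
by rewrite -scalerAl -scalerAr uv.
Qed.

Lemma hcent_scale b v w : hcent b v -> hcent b w -> exists2 l, l != 0 & w = l *: v.
Proof.
move=> [v0 bv uv] [w0 bw uw].
have [l wl] := proportional lenP hM (lt0r_neq0 a_gt0) u0 au bv bw uv uw v0.
by exists l => //; apply: contraNneq w0 => l0; rewrite wl l0 scale0r.
Qed.

Lemma hcent_commensurable b v : hcent b v ->
  exists n i i', (0 < n)%N /\ b *+ n + a *+ i' = a *+ i.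
Proof.
move=> [v0 bv uv]; have [->|b0] := eqVneq b 0.
  by exists 1%N, 0%N, 0%N; rewrite !mulr0n addr0.
exact: (commensurable lenP hM (lt0r_neq0 a_gt0) u0 au b0 v0 bv uv).
Qed.

(* For [b < 0] some [u ^+ m * v ^+ n] would be a scalar, making [u] a unit. *)
Lemma hcent_ge0 b v : hcent b v -> 0 <= b.
Proof.
move=> Cv; rewrite leNgt; apply/negP => b_lt0.
have [n [i [i' [n0 e]]]] := hcent_commensurable Cv.
have lt_ii' : (i < i')%N.
  by rewrite -(ltr_pMn2l a_gt0) -e gtrDr pmulrn_llt0.
have [m mE] : exists m, i' = (i + m.+1)%N.
  by exists (i' - i.+1)%N; rewrite addnS -addSn subnKC.
have e0 : a *+ m.+1 + b *+ n = 0.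
  apply: (addrI (a *+ i)); rewrite addr0 addrA -mulrnDr -mE addrC //.
have := hcentM (hcentX m.+1 hcentu) (hcentX n Cv).
rewrite e0 => /(hcent_scale hcent1)[l l0]; rewrite exprS -mulrA => /(unit_monomial lenP l0).
exact/negP.
Qed.

Lemma hcent_power b v : hcent b v -> exists n m, (0 < n)%N /\ b *+ n = a *+ m.
Proof.
move=> Cv; have [n [i [i' [n0 e]]]] := hcent_commensurable Cv.
exists n, (i - i')%N; split=> //; rewrite mulrnBr; first by rewrite -e addrK.
by rewrite -(ler_pMn2l a_gt0) -e lerDr mulrn_wge0 // (hcent_ge0 Cv).
Qed.

(** A monomial is invertible, and its inverse would lie in the centralizer with negative degree. *)
Lemma hcent_nonmonomial b v : 0 < b -> hcent b v -> ~~ monomial v.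
Proof.
move=> b0 [v0 bv uv]; apply/negP; rewrite /monomial => /cardfs1P[g vg].
have [x [x0 vx]] : exists x : k, x != 0 /\ v = << x *g g >>.
  exists v@_g; rewrite mcoeff_neq0 {1}vg inE; split=> //.
  by rewrite {1}[v]galg_sum vg big_seq_fset1.
pose v' : kG := << x^-1 *g (g^-1)%g >>.
have vv' : v * v' = 1 by rewrite vx galgUM mulfV // mulgV.
have v'v : v' * v = 1 by rewrite vx galgUM mulVf // mulVg.
have : hcent (- b) v'.
  split.
  - by rewrite monalgU_eq0 invr_eq0.
  - have -> : - b = h (g^-1)%g; last exact: gradedU.
    rewrite hV //; congr (- _); apply: (graded_inj v0 bv); rewrite vx; exact: gradedU.
  by rewrite -[LHS]mul1r -v'v -!mulrA [v * (u * _)]mulrA -uv -mulrA vv' mulr1.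
by move/hcent_ge0; rewrite oppr_ge0 leNgt b0.
Qed.

Lemma hcent_ratio b c v w : 0 < b -> hcent b v -> 0 < c -> hcent c w ->
  exists p q, [/\ (0 < p)%N, (0 < q)%N, coprime p q & c *+ q = b *+ p].
Proof.
move=> b0 Cv c0 Cw; have [n [m [n0 e]]] := hcent_power Cv.
have [n' [m' [n'0 e']]] := hcent_power Cw.
have pos d r i : 0 < d -> (0 < r)%N -> d *+ r = a *+ i -> (0 < i)%N.
  move=> d0 r0 E; rewrite lt0n; apply: contraTneq d0 => i0.
  by rewrite -(pmulrn_lgt0 d r0) E i0 mulr0n ltxx.
have m0 := pos _ _ _ b0 n0 e; have m'0 := pos _ _ _ c0 n'0 e'.
have E : c *+ (n' * m) = b *+ (n * m').
  by rewrite !mulrnA e e' -!mulrnA mulnC.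
have N0 : (0 < n * m')%N by rewrite muln_gt0 n0.
have M0 : (0 < n' * m)%N by rewrite muln_gt0 n'0.
move: (n * m')%N (n' * m)%N N0 M0 E => p q p0 q0 E.
have g0 : (0 < gcdn p q)%N by rewrite gcdn_gt0 p0.
exists (p %/ gcdn p q)%N, (q %/ gcdn p q)%N; split.
- by rewrite divn_gt0 // dvdn_leq // dvdn_gcdl.
- by rewrite divn_gt0 // dvdn_leq // dvdn_gcdr.
- by rewrite /coprime -(eqn_pmul2r g0) muln_gcdl !divnK ?dvdn_gcdl ?dvdn_gcdr ?mul1n.
by apply: (pmulrnI g0); rewrite -!mulrnA !divnK ?dvdn_gcdl ?dvdn_gcdr.
Qed.

(** [v w] and [w v] have the same degree, so [w v = l v w] for a scalar [l]. For coprime [p], [q]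
    the powers [v^p] and [w^q] are proportional, so each commutes with both elements; this forces
    [l^p = l^q = 1]. *)
Lemma hcent_comm b c v w : 0 < b -> hcent b v -> 0 < c -> hcent c w -> v * w = w * v.
Proof.
move=> b0 Cv c0 Cw; have [p [q [p0 q0 pq e]]] := hcent_ratio b0 Cv c0 Cw.
have Cvp := hcentX p Cv; rewrite -e in Cvp.
have [m m0 wq] := hcent_scale Cvp (hcentX q Cw).
have vwC := hcentM Cv Cw; have wvC := hcentM Cw Cv; rewrite addrC in wvC.
have [l l0 wv] := hcent_scale vwC wvC.
have vwq : v * w ^+ q = w ^+ q * v.
  by rewrite wq -scalerAl -scalerAr -exprS -exprSr.
have vpw : v ^+ p * w = w * v ^+ p.
  by apply: (scalerI m0); rewrite scalerAl scalerAr -wq -exprS -exprSr.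
have fixed y (x : k) : x *: y = y -> y != 0 -> x = 1.
  move=> xy y0; apply/eqP; rewrite -subr_eq0; apply: contraNT y0 => x1.
  by apply/eqP/(scalerI x1); rewrite scaler0 scalerBl scale1r xy subrr.
suff l1 : l = 1 by rewrite wv l1 scale1r.
have [vwq0 _ _] := hcentM Cv (hcentX q Cw).
have [vpw0 _ _] := hcentM (hcentX p Cv) Cw.
apply: (coprime_expf p0 pq).
  by apply: fixed vpw0; rewrite -(scale_comm_Xr _ wv) vpw.
by apply: fixed vwq0; rewrite -(scale_comm_Xl _ wv) vwq.
Qed.

(** [w^q] is a scalar times [v^p] with [q <= p], hence a left multiple of [v^q], and
    [root_divisible] divides [w] by [v]. The quotient need not be known homogeneous: its component
    of degree [c - b] serves as well. *)
Lemma hcent_divide b c v w : 0 <= b -> b <= c -> hcent b v -> hcent c w ->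
  exists x, hcent (c - b) x.
Proof.
rewrite le_eqVlt => /predU1P[<-|b0] bc Cv Cw; first by exists w; rewrite subr0.
have c0 := lt_le_trans b0 bc.
have [p [q [p0 q0 pq e]]] := hcent_ratio b0 Cv c0 Cw.
have le_qp : (q <= p)%N by rewrite -(ler_pMn2l b0) -e ler_wMn2r.
have Cvp := hcentX p Cv; rewrite -e in Cvp.
have [m m0 wq] := hcent_scale Cvp (hcentX q Cw).
have [v0 bv uv] := Cv; have [w0 cw uw] := Cw.
have [x wx] : exists x, w = x * v.
  apply: (root_divisible (z := m *: v ^+ (p - q)) (n := q.-1) lenP v0).
    exact: hcent_comm b0 Cv c0 Cw.
  by rewrite prednK // -scalerAl -exprD subnK.
have wx' : w = hproj h (c - b) x * v.
  by rewrite -(hprojMl hM) // -wx (hproj_id _ cw) eqxx.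
move: (hproj h (c - b) x) (hproj_graded (h := h) (b := c - b) x) wx' => {x wx} x cx wx.
exists x; split=> //; first by apply: contraNneq w0 => x0; rewrite wx x0 mul0r.
apply: (galg_mulIf lenP v0); move: uw; rewrite wx mulrA => ->.
by rewrite -!mulrA uv.
Qed.

(* A homogeneous element of positive degree and minimal diameter is not a proper
   power up to scalars, and the degrees of the centralizer are closed under
   positive differences. *)
Lemma hcent_generator : exists b t, [/\ 0 < b, hcent b t &
  forall c w, hcent c w -> exists n l, w = l *: t ^+ n].
Proof.
pose P n := `[< exists b t, [/\ 0 < b, hcent b t & diam len t = n] >].
have exP : exists n, P n by exists (diam len u); apply/asboolP; exists a, u.
have [d /asboolP[b [t [b0 Ct td]]] d_min] := ex_minnP exP.
exists b, t; split=> // c w Cw.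
have := hcent_ge0 Cw; rewrite le_eqVlt => /predU1P[c0|c0].
  rewrite -c0 in Cw; have [l _ wl] := hcent_scale hcent1 Cw.
  by exists 0%N, l.
have [p [q [p0 q0 pq e]]] := hcent_ratio b0 Ct c0 Cw.
have [i i' ii' _] := egcdnP q p0; rewrite (eqP pq) in ii'.
(* From [i p = i' q + 1] and [c q = b p], [beta] is [b / q]. *)
set beta := c *+ i - b *+ i'.
have betaq : beta *+ q = b.
  by rewrite mulrnBl -!mulrnA [(i * q)%N]mulnC mulrnA e -mulrnA mulnC ii' mulrnDr addrC addKr.
have beta0 : 0 < beta by rewrite -(pmulrn_lgt0 beta q0) betaq.
have [||x Cx] := hcent_divide _ _ (hcentX i' Ct) (hcentX i Cw).
- by rewrite mulrn_wge0 // ltW.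
- by rewrite -subr_ge0 ltW.
rewrite -/beta in Cx; have Cxq := hcentX q Cx; rewrite betaq in Cxq.
have [l l0 tx] := hcent_scale Cxq Ct.
suff q1 : q = 1%N.
  have Ctp := hcentX p Ct; rewrite -e q1 mulr1n in Ctp.
  by have [m _ wm] := hcent_scale Ctp Cw; exists p, m.
(* For [q >= 2], [t] would be a nonmonomial times [x], giving [x] a smaller diameter than [t]. *)
case: q q0 tx {pq e ii' betaq Cxq} => [|[|q]] // _ tx; exfalso.
have Cy : hcent (beta *+ q.+1) (l *: x ^+ q.+1) by apply/hcentZ/hcentX.
have [y0 _ _] := Cy; have [x0 _ _] := Cx.
have ny : ~~ monomial (l *: x ^+ q.+1).
  by apply: (hcent_nonmonomial _ Cy); rewrite pmulrn_lgt0.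
have := diam_lt_mul lenP y0 ny x0; rewrite -scalerAl -exprSr -tx td ltnNge.
by rewrite d_min //; apply/asboolP; exists beta, x.
Qed.

End GradedCentralizer.

(** * The isomorphism with k[t] *)

Section PolynomialCentralizer.
Variables (k : fieldType) (B : algType k) (u t : B).
Hypothesis t_comm : u * t = t * u.
Hypothesis t_gen : forall v, u * v = v * u -> exists p, v = horner_alg t p.
Hypothesis t_free : forall p, horner_alg t p = 0 -> p = 0.
Local Notation C := (centralizer_algebra u).

Lemma horner_alg_centralizer p : horner_alg t p \in centralizer u.
Proof.
rewrite inE; apply/eqP; elim/poly_ind: p => [|p x IH].
  by rewrite rmorph0 mulr0 mul0r.
rewrite rmorphD rmorphM /= horner_algX horner_algC mulrDr mulrDl -scalerAr -scalerAl.
by rewrite mulr1 mul1r mulrA IH -!mulrA t_comm.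
Qed.

Lemma centralizer_poly_ex (v : C) : exists p, val v == horner_alg t p.
Proof. by case: v => v /= /eqP/t_gen[p ->]; exists p. Qed.

(** [alg_isomorphic] asks for a map out of the centralizer, so this is the inverse of evaluation at
    [t], picked by choice; uniqueness from [t_free] makes it a morphism. *)
Definition centralizer_poly (v : C) : {poly k} := xchoose (centralizer_poly_ex v).

Lemma horner_centralizer_poly v : horner_alg t (centralizer_poly v) = val v.
Proof. by apply/esym/eqP; exact: (xchooseP (centralizer_poly_ex v)). Qed.

Lemma centralizer_polyE v p : val v = horner_alg t p -> centralizer_poly v = p.
Proof.
move=> vp; apply/subr0_eq/t_free.
by rewrite rmorphB /= horner_centralizer_poly vp subrr.
Qed.

Lemma centralizer_poly_linear : linear centralizer_poly.
Proof.
move=> x v w; apply: centralizer_polyE.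
by rewrite [RHS]linearP /= !horner_centralizer_poly mulr_algl.
Qed.

Lemma centralizer_poly_multiplicative : monoid_morphism centralizer_poly.
Proof.
split=> [|v w]; apply: centralizer_polyE; first by rewrite !rmorph1.
by rewrite !rmorphM /= !horner_centralizer_poly.
Qed.

HB.instance Definition _ := GRing.isLinear.Build k C {poly k} _ centralizer_poly
  centralizer_poly_linear.
HB.instance Definition _ := GRing.isMonoidMorphism.Build C {poly k} centralizer_poly
  centralizer_poly_multiplicative.

Lemma centralizer_poly_isomorphic : alg_isomorphic C {poly k}.
Proof.
exists centralizer_poly.
exists (fun p => Centralizer (horner_alg_centralizer p)) => [v|p].
  by apply: val_inj; rewrite /= horner_centralizer_poly.
exact: centralizer_polyE.
Qed.

End PolynomialCentralizer.

Section PositiveDegree.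
Variables (G : groupType) (len : G -> nat) (R : realDomainType) (k : fieldType).
Variable h : G -> R.
Hypothesis lenP : tree_length len.
Hypothesis hM : {morph h : x y / (x * y)%g >-> x + y}.
Local Notation kG := (group_algebra k G).
Implicit Types (u v t : kG) (a b : R).

Lemma horner_algE t (p : {poly k}) :
  horner_alg t p = \sum_(i < size p) p`_i *: t ^+ i.
Proof.
rewrite {1}[p](esym (coefK p)) poly_def linear_sum /=; apply: eq_bigr => i _.
by rewrite linearZ /= rmorphXn /= horner_algX mulr_algl.
Qed.

Lemma centralizer_positive_degree a u : 0 < a -> u != 0 -> graded h a u ->
  ~~ monomial u -> alg_isomorphic (centralizer_algebra u) {poly k}.
Proof.
move=> a0 u0 au mu.
have [b [t [b0 [t0 bt ut] gen]]] := hcent_generator lenP hM a0 u0 au mu.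
apply: (centralizer_poly_isomorphic ut) => [v uv|p p0].
  rewrite [v](hproj_sum h); elim: (undup _) => [|c s [p IH]].
    by exists 0; rewrite big_nil rmorph0.
  rewrite big_cons IH; have [->|c0] := eqVneq (hproj h c v) 0.
    by exists p; rewrite add0r.
  have [|n [l ->]] := gen c (hproj h c v).
    by split; [| exact: hproj_graded | exact: (hproj_comm hM _ au uv)].
  by exists (l *: 'X^n + p); rewrite linearP /= rmorphXn /= horner_algX mulr_algl.
apply/eqP; apply: contraT => pn0.
have lt_s : ((size p).-1 < size p)%N by rewrite prednK // size_poly_gt0.
have := hproj_poly hM (size p).-1 (size p) p (lt0r_neq0 b0) bt.
rewrite -horner_algE p0 raddf0 lt_s -lead_coefE => /esym/eqP.
by rewrite scaler_eq0 lead_coef_eq0 (negPf pn0) (negPf (galg_expf_neq0 lenP _ t0)).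
Qed.

End PositiveDegree.

Theorem proposition6p6 (R : realType) (k : fieldType) (A : finType)
    (h : free_group A -> R) (a : R) (u : group_algebra k (free_group A)) :
  {morph h : x y / (x * y)%g >-> x + y} ->
  homogeneous h a u -> a != 0 -> ~~ monomial u ->
  alg_isomorphic (centralizer_algebra u) {poly k}.
Proof.
move=> hM [u0 au] a0 mu.
have gu : graded h a u by move=> g; apply: contraNeq; rewrite mcoeff_neq0 => /au ->.
case: (ltgtP 0 a) a0 => // a0.
  move=> _; exact: (centralizer_positive_degree (@word_tree_length A) hM a0).
(* A negative degree becomes positive for [- h], and the centralizer does not depend on [h]. *)
have hNM : {morph (fun g => - h g) : x y / (x * y)%g >-> x + y}.
  by move=> x y; rewrite hM opprD.
have a0' : 0 < - a by rewrite oppr_gt0.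
move=> _; apply: (centralizer_positive_degree (@word_tree_length A) hNM a0') => //.
by move=> g; rewrite eqr_opp; apply: gu.
Qed.
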